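(* Let $X$ be a fractional Brownian motion with Hurst parameter $H=1/6$, and let $T>0$. Then $X$ does not have a cubic variation in the mean-square sense, i.e. $[X,3]_\varepsilon(T)$ has no limit in $L^2(\Omega)$ as $\varepsilon\to0^+$. In fact more is true: $[X,3]_\varepsilon(T)$ has no limit in probability as $\varepsilon\to0^+$.
   Context: Fractional Brownian motion with Hurst parameter $H\in(0,1)$ is the centered Gaussian process $(X(t))_{t\ge0}$ with covariance $\mathbf{E}[X(t)X(s)]=\frac12\left(s^{2H}+t^{2H}-|t-s|^{2H}\right)$ (taken in its continuous version). For $\varepsilon>0$, $$[X,3]_\varepsilon(T):=\frac1\varepsilon\int_0^T\left(X(s+\varepsilon)-X(s)\right)^3ds.$$ *)

(* Defs.v *)
From HB Require Import structures.
From mathcomp Require Import all_boot all_order all_algebra.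
From mathcomp Require Import all_classical all_reals all_analysis.

Set Implicit Arguments.
Unset Strict Implicit.
Unset Printing Implicit Defensive.

Import Order.TTheory GRing.Theory Num.Theory.
Import numFieldNormedType.Exports.

Local Open Scope classical_set_scope.
Local Open Scope ring_scope.

(* [normal_prob m 0] is, by convention of the library, the uniform law on
   [0, 1]; the degenerate Gaussian law is the Dirac mass at the mean.
   [s] is the standard deviation. *)
Definition gaussian_law (R : realType) (m s : R) (A : set R) : \bar R :=
  if s == 0 then \d_m A else normal_prob m s A.

Definition gaussian_rv (R : realType) (d : measure_display)
    (Omega : measurableType d) (P : probability Omega R) (Y : Omega -> R) :=
  exists m s : R, 0 <= s /\
    forall A : set R, measurable A -> pushforward P Y A = gaussian_law m s A.

(* Time is indexed by the whole of R; only the times t >= 0 are constrained. *)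
Definition gaussian_process (R : realType) (d : measure_display)
    (Omega : measurableType d) (P : probability Omega R)
    (X : R -> {RV P >-> R}) :=
  forall (n : nat) (t c : 'I_n -> R), (forall i, 0 <= t i) ->
    gaussian_rv P (fun w => \sum_(i < n) c i * X (t i) w).

Record fractional_brownian_motion (R : realType) (d : measure_display)
    (Omega : measurableType d) (P : probability Omega R) (H : R)
    (X : R -> {RV P >-> R}) : Prop := {
  fbm_hurst : 0 < H < 1 ;
  fbm_gaussian : gaussian_process X ;
  fbm_centered : forall t : R, 0 <= t -> ('E_P[X t] = 0)%E ;
  fbm_cov : forall s t : R, 0 <= s -> 0 <= t ->
    ('E_P[X t \* X s])%E =
      (2^-1 * (s `^ (2 * H) + t `^ (2 * H) - `|t - s| `^ (2 * H)))%:E ;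
  fbm_continuous : forall w : Omega,
    {within `[0, +oo[, continuous (fun t : R => X t w)} }.

Definition cubic_variation (R : realType) (d : measure_display)
    (Omega : measurableType d) (P : probability Omega R)
    (X : R -> {RV P >-> R}) (T eps : R) (w : Omega) : R :=
  eps^-1 * \int[lebesgue_measure]_(s in `[0, T]) (X (s + eps) w - X s w) ^+ 3.

Definition cvg_in_L2 (R : realType) (d : measure_display)
    (Omega : measurableType d) (P : probability Omega R)
    (V : R -> Omega -> R) (F : set_system R) (Y : Omega -> R) :=
  Y \in Lfun P 2%:E /\
  Lnorm P 2%:E (fun w => (V eps w - Y w)%:E) @[eps --> F] --> (0 : \bar R).

Definition cvg_in_probability (R : realType) (d : measure_display)
    (Omega : measurableType d) (P : probability Omega R)
    (V : R -> Omega -> R) (F : set_system R) (Y : {RV P >-> R}) :=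
  forall delta : R, 0 < delta ->
    P [set w | delta <= `|V eps w - Y w|] @[eps --> F] --> (0 : \bar R).

(* Main.v *)
Require Import Defs.
From HB Require Import structures.
From mathcomp Require Import all_boot all_order all_algebra.
From mathcomp Require Import all_classical all_reals all_analysis.
From mathcomp Require Import measurable_realfun.
From mathcomp Require Import ring lra.
Set Implicit Arguments.
Unset Strict Implicit.
Unset Printing Implicit Defensive.
Import Order.TTheory GRing.Theory Num.Theory.
Import numFieldNormedType.Exports.
Local Open Scope classical_set_scope.
Local Open Scope ring_scope.

(** Write [V e] for the cubic variation at scale [e]. The increment of the process
    from [s] to [s + e] has variance [cbrt e], where [cbrt x = |x| ^ (1/3)], and the
    correlation of the increments starting at [s] and [t] is [rho ((s - t) / e)], where
    [rho = incr_corr] is half the second difference of [cbrt]. The exponent 1/6 is the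
    critical one: the mean of the product of the cubes of two increments is exactly
    [e (9 rho + 6 rho ^ 3)], so that the second moment of [V e] neither vanishes nor
    explodes. As [e] tends to [0], [V e] keeps fluctuating at the finest scale, and these
    fluctuations are asymptotically independent of everything that happens at a fixed scale.
    So the family cannot be Cauchy.

    One test variable detects these fluctuations. Let [Z = sinh_sum X e N] be the sum of
    [sinh], suitably normalized, over the standardized increments along the grid of step
    [e]. Four bounds carry the proof.

    - The second moments of [V e] are bounded ([mean_cubic_variation_sqr_le]), because [rho]
      is integrable.
    - The fourth moments of [Z] are bounded ([mean_sinh_sum_pow4_le]). The mean of a product
      of four hyperbolic sines of Gaussian variables is an explicit combination of
      hyperbolic functions of their correlations ([mean_sinh4]), and [rho] is summable along
      the grid.
    - The mean of [V e Z] is bounded below by a positive constant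
      ([mean_cubic_variation_sinh_sum_ge]). This comes down to lower bounds for the sums of
      [rho] and of its cube over the integer translates of a point. The first one telescopes
      and is nonnegative; the second one telescopes up to terms of nonnegative sum, one of
      which is bounded away from zero by strict concavity of the cube root
      ([sum_incr_corr_cube_ge]).
    - For fixed [e'], the mean of [V e' Z] is [O(cbrt e)]
      ([mean_cubic_variation_sinh_sum_small]), because the covariances of an increment of
      length [e'] with the steps of the grid are differences of [cbrt] along the grid.

    Hence the mean of [(V e - V e') Z] stays away from zero as [e] tends to [0]. By the moment
    bounds and a truncation ([mul_le_tail]), [V e - V e'] cannot tend to zero in probability
    ([not_cauchy_in_probability]), and there is no limit in probability. A limit in mean
    square would be a limit in probability, by Markov's inequality.

    Moments of Gaussian variables are obtained from Laplace transforms only: for a linear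
    combination of values of the process it is the exponential of half the variance, and
    mixed moments up to order three are read off as coefficients of an expansion at [0]
    ([mean_cubic_coeffs]). *)

(** * Cube roots *)

Section cube_root.
Context {R : realType}.
Implicit Types x y v : R.

(** The exponent is [2H] for [H = 1/6], so that the covariances of the process are
    combinations of values of [cbrt]; the absolute value makes [cbrt] even. *)
Definition cbrt x : R := `|x| `^ (2 * 6^-1).

Lemma cbrt_ge0 x : 0 <= cbrt x.
Proof. exact: powR_ge0. Qed.

Lemma cbrt_exp3 x : cbrt x ^+ 3 = `|x|.
Proof.
rewrite /cbrt -powR_mulrn ?powR_ge0// -powRrM.
by rewrite (_ : _ * 3%:R = 1) ?powRr1//; field.
Qed.

Lemma cbrtN x : cbrt (- x) = cbrt x.
Proof. by rewrite /cbrt normrN. Qed.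

Lemma cbrt0 : cbrt 0 = 0.
Proof. by rewrite /cbrt normr0 powR0//; apply/eqP; lra. Qed.

Lemma cbrt1 : cbrt 1 = 1.
Proof. by rewrite /cbrt normr1 powR1. Qed.

Lemma cbrtM x y : cbrt (x * y) = cbrt x * cbrt y.
Proof. by rewrite /cbrt normrM powRM. Qed.

Lemma cbrt_gt0 x : x != 0 -> 0 < cbrt x.
Proof. by move=> x0; rewrite /cbrt powR_gt0// normr_gt0. Qed.

Lemma le_cbrt x y : `|x| <= `|y| -> cbrt x <= cbrt y.
Proof. by move=> xy; rewrite /cbrt ge0_ler_powR//= ?nnegrE//; lra. Qed.

(** Concavity of the cube root without derivatives: in
    [x^3 + y^3 = (x + y) ((x + y)^2 + 3 (y - x)^2) / 4] the right-hand side grows with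
    the sum and with the gap, so of two pairs with the same sum of cubes the one with
    the wider gap has the smaller sum. *)
Lemma cubes_concave (p q r s : R) : 0 <= p -> p <= q -> q <= r -> r <= s ->
  p ^+ 3 + s ^+ 3 = q ^+ 3 + r ^+ 3 -> p + s <= q + r.
Proof.
move=> p0 pq qr rs e; rewrite leNgt; apply/negP => h.
have sum3 x y : x ^+ 3 + y ^+ 3 = (x + y) * ((x + y) ^+ 2 + 3 * (y - x) ^+ 2) / 4 :> R.
  by field.
move: e; rewrite !sum3.
have : (r - q) ^+ 2 <= (s - p) ^+ 2 by rewrite lerXn2r ?nnegrE; lra.
have : (q + r) ^+ 2 < (p + s) ^+ 2 by rewrite ltrXn2r// ?nnegrE; lra.
set A := (q + r) ^+ 2; set B := (r - q) ^+ 2; set C := (p + s) ^+ 2.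
have B0 : 0 <= B by exact: sqr_ge0.
have A0 : 0 <= A by exact: sqr_ge0.
set D := (s - p) ^+ 2.
move=> AC BD.
suff : (q + r) * (A + 3 * B) < (p + s) * (C + 3 * D) by lra.
apply: ltr_pM; lra.
Qed.

Lemma cbrt_concave (a b c d : R) : 0 <= a -> a <= b -> b <= c -> c <= d ->
  a + d = b + c -> cbrt a + cbrt d <= cbrt b + cbrt c.
Proof.
move=> a0 ab bc cd e; apply: cubes_concave; rewrite ?cbrt_ge0//.
- by apply: le_cbrt; rewrite !ger0_norm//; lra.
- by apply: le_cbrt; rewrite !ger0_norm//; lra.
- by apply: le_cbrt; rewrite !ger0_norm//; lra.
- by rewrite !cbrt_exp3 !ger0_norm//; lra.
Qed.

Lemma cbrt_subadd x y : cbrt (x + y) <= cbrt x + cbrt y.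
Proof.
apply: (@le_trans _ _ (cbrt (`|x| + `|y|))).
  by apply: le_cbrt; rewrite [leRHS]ger0_norm ?ler_normD// addr_ge0.
have e z : cbrt z = cbrt `|z| by rewrite /cbrt normr_id.
rewrite [cbrt x]e [cbrt y]e.
wlog xy : x y / `|x| <= `|y|.
  move=> H; have [/H//|/ltW/H] := leP `|x| `|y|.
  by rewrite addrC [_ + cbrt `|x|]addrC.
rewrite -[leLHS]add0r -cbrt0.
by apply: cbrt_concave => //; rewrite ?ler_wpDl ?add0r//.
Qed.

Lemma cbrt_dist x y : `|cbrt x - cbrt y| <= cbrt (x - y).
Proof.
have := cbrt_subadd (x - y) y; have := cbrt_subadd (y - x) x.
rewrite !subrK -(opprB x y) cbrtN => h1 h2.
by rewrite ler_norml; apply/andP; split; lra.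
Qed.

Lemma continuous_cbrt : continuous (cbrt : R -> R).
Proof.
move=> x; apply/cvgrPdist_lt => e e0; near=> y.
apply: le_lt_trans (cbrt_dist _ _) _.
rewrite -(@ltr_pXn2r _ 3)// ?nnegrE ?cbrt_ge0 ?(ltW e0)// cbrt_exp3.
near: y; apply: (@cvgr_dist_lt _ _ _ (nbhs x) _ id x) => //.
exact: exprn_gt0.
Unshelve. all: by end_near.
Qed.
End cube_root.

(** * The correlation function of the increments *)

Section increment_correlation.
Context {R : realType}.
Implicit Types x y v : R.

(** [incr_corr] is the difference of [half_incr] at two points at distance 1, so its
    sums over integer translates telescope. *)
Definition half_incr y : R := (cbrt (y + 1) - cbrt y) / 2.
(** With [y = (s - t) / e], the correlation of the increments of length [e] that start at
    [s] and at [t]. *)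
Definition incr_corr y : R := half_incr y - half_incr (y - 1).
Local Notation h := half_incr.
Local Notation rho := incr_corr.

Lemma incr_corrE y : rho y = (cbrt (y + 1) + cbrt (y - 1)) / 2 - cbrt y.
Proof. by rewrite /rho /h subrK; field. Qed.

Lemma half_incr_refl y : h (- y - 1) = - h y.
Proof. by rewrite /h subrK -opprD !cbrtN; field. Qed.

Lemma incr_corrN y : rho (- y) = rho y.
Proof.
rewrite !incr_corrE -(cbrtN (- y + 1)) -(cbrtN (- y - 1)) (cbrtN y) !opprD !opprK.
by rewrite (addrC (cbrt (y - 1))).
Qed.

Lemma half_incr_ge0 y : - 2^-1 <= y -> 0 <= h y.
Proof.
move=> y0; rewrite /h divr_ge0// subr_ge0; apply: le_cbrt.
by rewrite [leRHS]ger0_norm ?ler_norml; first apply/andP; lra.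
Qed.

Lemma half_incr_le0 y : y <= - 2^-1 -> h y <= 0.
Proof.
move=> y0; rewrite -[y]opprK -[- - y](addrK 1) opprK.
rewrite (_ : y + 1 - 1 = - (- y - 1) - 1); last by ring.
by rewrite half_incr_refl oppr_le0 half_incr_ge0//; lra.
Qed.

Lemma half_incr_bound y : `|h y| <= 2^-1.
Proof.
have := cbrt_dist (y + 1) y; rewrite (_ : y + 1 - y = 1); last by ring.
by rewrite cbrt1 /h !ler_norml => /andP[a b]; apply/andP; split; lra.
Qed.

Lemma half_incr_decr x y : 0 <= x -> x <= y -> h y <= h x.
Proof.
move=> x0 xy; suff : cbrt x + cbrt (y + 1) <= cbrt (x + 1) + cbrt y by rewrite /h; lra.
have [x1y|/ltW yx1] := leP (x + 1) y.
  by apply: cbrt_concave => //; lra.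
by rewrite [leRHS]addrC; apply: cbrt_concave => //; lra.
Qed.

(** Away from the overlap zone the correlation is a second difference of a concave
    function. *)
Lemma incr_corr_ge1 y : 1 <= `|y| -> rho y <= 0.
Proof.
wlog y0 : y / 0 <= y => [H y1|].
  have [/H|/ltW y0] := leP 0 y; first exact.
  by rewrite -incr_corrN H ?normrN// oppr_ge0.
by rewrite ger0_norm// => y1; rewrite subr_le0 half_incr_decr; lra.
Qed.

Lemma incr_corr_decr x y : 0 <= x -> x <= y -> y <= 1 -> rho y <= rho x.
Proof.
move=> x0 xy y1; rewrite !incr_corrE.
have : cbrt x <= cbrt y by apply: le_cbrt; rewrite !ger0_norm; lra.
rewrite -!(cbrtN (_ - 1)) !opprB.
have : cbrt (1 - y) + cbrt (1 + y) <= cbrt (1 - x) + cbrt (1 + x).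
  by apply: cbrt_concave; lra.
by rewrite !(addrC _ 1); lra.
Qed.

Lemma incr_corr0 : rho 0 = 1.
Proof. by rewrite incr_corrE sub0r add0r cbrtN cbrt1 cbrt0; lra. Qed.

Lemma incr_corr_norm y : `|rho y| <= 1.
Proof.
have := half_incr_bound y; have := half_incr_bound (y - 1).
by rewrite /rho !ler_norml => /andP[a b] /andP[c d]; apply/andP; split; lra.
Qed.

(** A bounded function whose unit decrements dominate the modulus of the correlation.
    Where the correlation is nonpositive, [- half_incr] does it alone; on [-1, 1], the
    clamped linear term contributes an extra 2, which is at least twice the correlation.
    Sums and integrals of the modulus of the correlation thus telescope to bounded
    quantities. *)
Definition corr_var y : R := 2 * Num.min 3 (Num.max 0 (y + 2)) - h y.

Lemma corr_var_bound y : `|corr_var y| <= 7.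
Proof.
have := half_incr_bound y; rewrite /corr_var ler_norml => /andP[a b].
have a1 : 0 <= Num.min 3 (Num.max 0 (y + 2)) by rewrite le_min le_max lexx; lra.
have b1 : Num.min 3 (Num.max 0 (y + 2)) <= 3 by rewrite ge_min lexx.
by rewrite ler_norml; apply/andP; split; lra.
Qed.

Lemma incr_corr_le_var y : `|rho y| <= corr_var y - corr_var (y - 1).
Proof.
have := incr_corr_norm y; rewrite ler_norml => /andP[a b].
have -> : corr_var y - corr_var (y - 1) = 2 * (Num.min 3 (Num.max 0 (y + 2)) -
   Num.min 3 (Num.max 0 (y - 1 + 2))) - rho y.
  by rewrite /corr_var /rho; lra.
have [y1|y1] := leP 1 `|y|.
  rewrite (ler0_norm (incr_corr_ge1 y1)) lerDr pmulr_rge0// subr_ge0.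
  apply: le_min2 => //; apply: le_max2 => //; lra.
move: y1; rewrite ltr_norml ler_norml => /andP[y0 y1].
have -> : Num.max 0 (y + 2) = y + 2 by apply/max_idPr; lra.
have -> : Num.max 0 (y - 1 + 2) = y - 1 + 2 by apply/max_idPr; lra.
have -> : Num.min 3 (y - 1 + 2) = y - 1 + 2 by apply/min_idPr; lra.
by rewrite /Num.min; case: ltP => _; apply/andP; split; lra.
Qed.

Lemma continuous_corr_var : continuous corr_var.
Proof.
move=> y.
have cD (a : R) : {for y, continuous (fun z : R => z + a)}.
  by apply: cvgD; [exact: cvg_id|exact: cvg_cst].
apply: cvgB.
  apply: cvgM; first exact: cvg_cst.
  apply: (@continuous_min R R (cst 3) (fun z => Num.max 0 (z + 2)) y).
    exact: cvg_cst.
  apply: (@continuous_max R R (cst 0) (fun z => z + 2) y) => //.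
  exact: cvg_cst.
apply: cvgM; last exact: cvg_cst.
apply: cvgB; last exact: continuous_cbrt.
by apply: (continuous_comp (cD 1)); exact: continuous_cbrt.
Qed.

Lemma sum_incr_corr_norm x N : \sum_(k < N) `|rho (x - k%:R)| <= 14.
Proof.
apply: (@le_trans _ _ (corr_var x - corr_var (x - N%:R))); last first.
  have := corr_var_bound x; have := corr_var_bound (x - N%:R).
  by rewrite !ler_norml => /andP[? ?] /andP[? ?]; lra.
elim: N => [|N IH]; first by rewrite big_ord0 subr0 subrr.
rewrite big_ord_recr/=; have := incr_corr_le_var (x - N%:R).
rewrite (_ : x - N.+1%:R = x - N%:R - 1); first by lra.
by rewrite -natr1; ring.
Qed.

Lemma sum_telescope_down (f : R -> R) x N :
  \sum_(k < N) (f (x - k%:R) - f (x - k%:R - 1)) = f x - f (x - N%:R).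
Proof.
elim: N => [|N IH]; first by rewrite big_ord0 subr0 subrr.
rewrite big_ord_recr/= IH (_ : x - N.+1%:R = x - N%:R - 1); first by lra.
by rewrite -natr1; ring.
Qed.

(** The defect of additivity of the cube in [(a - b)^3 = a^3 - b^3 - 3 a b (a - b)]: up to
    the sum of the [triple] terms, the sum of the cubed correlations telescopes. *)
Definition triple y : R := h y * h (y - 1) * (h (y - 1) - h y).

Lemma incr_corr_cube y : rho y ^+ 3 = h y ^+ 3 - h (y - 1) ^+ 3 + 3 * triple y.
Proof. by rewrite /rho /triple; ring. Qed.

Lemma tripleN y : triple (- y) = triple y.
Proof.
have -> : triple (- y) = h (- (y - 1) - 1) * h (- y - 1) * (h (- y - 1) - h (- (y - 1) - 1)).
  by rewrite /triple; do ?congr (_ * _); rewrite (_ : - (y - 1) - 1 = - y)//; ring.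
by rewrite !half_incr_refl /triple; ring.
Qed.

Lemma triple_ge0 y : 1 <= `|y| -> 0 <= triple y.
Proof.
wlog y0 : y / 0 <= y => [H y1|].
  have [/H|/ltW y0] := leP 0 y; first exact.
  by rewrite -tripleN H ?normrN// oppr_ge0.
rewrite ger0_norm// => y1; apply: mulr_ge0; first apply: mulr_ge0.
- by apply: half_incr_ge0; lra.
- by apply: half_incr_ge0; lra.
- by rewrite subr_ge0; apply: half_incr_decr; lra.
Qed.

(** At most two integer translates of a point lie strictly between [-1] and [1], where a
    single [triple] may be negative; their sum is not. By symmetry [v <= w := 1 - v], and then
    the sum is [h (- v) (h v rho v - h w rho w)] with [h] and [rho] nonincreasing on
    [0, 1]. *)
Lemma triple_pair_ge0 v : 0 <= v -> v <= 1 -> 0 <= triple v + triple (v - 1).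
Proof.
rewrite -(tripleN (v - 1)) opprB.
wlog v2 : v / v <= 2^-1 => [H v0 v1|].
  have [/H|/ltW v2] := leP v 2^-1; first exact.
  have := H (1 - v); rewrite (_ : 1 - (1 - v) = v); last by ring.
  by rewrite (addrC (triple v)) => H1; apply: H1; lra.
move=> v0 _; set w := 1 - v.
have hv1 : h (v - 1) = - h (- v) by rewrite -half_incr_refl opprK.
have hw1 : h (w - 1) = h (- v) by congr h; rewrite /w; ring.
have hv0 : 0 <= h v by apply: half_incr_ge0; lra.
have hw0 : 0 <= h w by apply: half_incr_ge0; rewrite /w; lra.
have hnv0 : 0 <= h (- v) by apply: half_incr_ge0; lra.
have rv0 : 0 <= rho v by rewrite /rho hv1; lra.
have -> : triple v + triple w = h (- v) * (h v * rho v - h w * rho w).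
  by rewrite /triple /rho hv1 hw1; ring.
apply: mulr_ge0 => //; rewrite subr_ge0.
apply: (@le_trans _ _ (h w * rho v)).
  by apply: ler_wpM2l => //; apply: incr_corr_decr; rewrite /w; lra.
by apply: ler_wpM2r => //; apply: half_incr_decr; rewrite /w; lra.
Qed.

(** For [p], [q] the cube roots of [y], [y + 1] one has [(q - p) (q^2 + q p + p^2) = 1],
    and [q <= 2]. *)
Lemma cbrt_incr_ge y : 0 <= y -> y <= 2 -> 12^-1 <= cbrt (y + 1) - cbrt y.
Proof.
move=> y0 y2.
have := cbrt_exp3 y; have := cbrt_exp3 (y + 1).
have : cbrt y <= cbrt (y + 1) by apply: le_cbrt; rewrite !ger0_norm; lra.
have := cbrt_ge0 y.
rewrite !ger0_norm; [|lra|lra].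
set p := cbrt y; set q := cbrt (y + 1) => p0 pq q3 p3.
have q2 : q <= 2 by rewrite -(@ler_pXn2r _ 3)// ?nnegrE; lra.
have : (q - p) * (q ^+ 2 + q * p + p ^+ 2) = 1.
  by transitivity (q ^+ 3 - p ^+ 3); [ring|rewrite q3 p3; ring].
have : q ^+ 2 + q * p + p ^+ 2 <= 12 by nra.
by nra.
Qed.

(** A quantitative form of strict concavity. For the cube roots [a], [b], [c] of
    [v], [v + 1], [v + 2], both [(b - a) (b^2 + b a + a^2)] and [(c - b) (c^2 + c b + b^2)]
    equal 1, so the gap between [b - a] and [c - b] factors explicitly. *)
Lemma half_incr_gap v : 0 <= v -> v <= 1 -> 12^-1 * 12^-1 * 12^-1 <= h v - h (v + 1).
Proof.
move=> v0 v1; have := @cbrt_incr_ge v; have := @cbrt_incr_ge (v + 1).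
rewrite /h; have := cbrt_exp3 v; have := cbrt_exp3 (v + 1).
have := cbrt_exp3 (v + 1 + 1); rewrite !ger0_norm; [|lra..].
have := cbrt_ge0 v; set a := cbrt v; set b := cbrt (v + 1).
set c := cbrt (v + 1 + 1) => a0 c3 b3 a3 /(_ ltac:(lra) ltac:(lra)) cb.
move=> /(_ ltac:(lra) ltac:(lra)) ba.
have b1 : 1 <= b by rewrite -(@ler_pXn2r _ 3)// ?nnegrE; lra.
have e : (b - a) - (c - b) = (b - a) * (c - b) * ((c - a) * (a + b + c)).
  have e1 : (b - a) * (b ^+ 2 + b * a + a ^+ 2) = 1.
    by transitivity (b ^+ 3 - a ^+ 3); [ring|rewrite b3 a3; ring].
  have e2 : (c - b) * (c ^+ 2 + c * b + b ^+ 2) = 1.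
    by transitivity (c ^+ 3 - b ^+ 3); [ring|rewrite c3 b3; ring].
  transitivity ((b - a) * ((c - b) * (c ^+ 2 + c * b + b ^+ 2)) -
                (c - b) * ((b - a) * (b ^+ 2 + b * a + a ^+ 2))); last by ring.
  by rewrite e1 e2 !mulr1.
suff : 12^-1 * 12^-1 * (6^-1 * 1) <= (b - a) * (c - b) * ((c - a) * (a + b + c)).
  by rewrite -e; lra.
apply: ler_pM; [lra|lra|apply: ler_pM; lra|apply: ler_pM; lra].
Qed.

(** The sum telescopes to [h x - h (x - N)]; the grid must reach beyond [x] for the last
    term to have the right sign. *)
Lemma sum_incr_corr_ge0 x N : 0 <= x -> x + 2 <= N%:R ->
  0 <= \sum_(k < N) rho (x - k%:R).
Proof.
move=> x0 xN; rewrite sum_telescope_down subr_ge0.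
by apply: (@le_trans _ _ 0); [apply: half_incr_le0|apply: half_incr_ge0]; lra.
Qed.

(** After telescoping, the sum is [h x ^ 3 - h (x - N) ^ 3] plus three times the sum of
    the [triple] terms, all of which are nonnegative once the two terms in [-1, 1] are
    paired. One of them is bounded away from 0: [h x ^ 3] if [x < 1], and otherwise the
    [triple] at the translate of [x] that lies in [1, 2]. *)
Lemma sum_incr_corr_cube_ge x N : 0 <= x -> x + 2 <= N%:R ->
  24^-1 * 24^-1 * (12^-1 * 12^-1 * 12^-1) <= \sum_(k < N) rho (x - k%:R) ^+ 3.
Proof.
move=> x0 xN.
under eq_bigr do rewrite incr_corr_cube.
rewrite big_split/= (sum_telescope_down (fun y => h y ^+ 3)) -mulr_sumr.
have hN : h (x - N%:R) ^+ 3 <= 0.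
  have : h (x - N%:R) <= 0 by apply: half_incr_le0; lra.
  by rewrite -oppr_ge0 => /(exprn_ge0 3); rewrite exprNn; lra.
(* The two translates of [x] in [-1, 1] are [v] and [v - 1]. *)
have /andP[jx xj] := truncn_itv x0; set j := Num.truncn x in jx xj.
have jN : (j.+2 <= N)%N by rewrite -(ler_nat R) -addn2 natrD; lra.
rewrite -natr1 in xj.
pose v := x - j%:R.
have sE : \sum_(k < N) triple (x - k%:R) = \sum_(0 <= k < j) triple (x - k%:R) +
    (triple v + triple (v - 1)) + \sum_(j.+2 <= k < N) triple (x - k%:R).
  rewrite -(big_mkord xpredT (fun k => triple (x - k%:R))).
  rewrite (@big_cat_nat _ _ _ j.+2)//=; congr (_ + _).
  rewrite big_nat_recr//= big_nat_recr//= -addrA; congr (_ + (_ + triple _)).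
  by rewrite /v -natr1; ring.
have vv : 0 <= triple v + triple (v - 1) by apply: triple_pair_ge0; rewrite /v; lra.
have tail : 0 <= \sum_(j.+2 <= k < N) triple (x - k%:R).
  rewrite big_nat; apply: sumr_ge0 => k /andP[jk _]; apply: triple_ge0.
  move: jk; rewrite -(ler_nat R) -addn2 natrD => jk.
  by rewrite ler0_norm; lra.
have hx : 0 <= h x by apply: half_incr_ge0; lra.
have [j0|j0] := posnP j.
  have : (24^-1 : R) ^+ 3 <= h x ^+ 3.
    apply: lerXn2r; rewrite ?nnegrE//.
    by move: xj; rewrite j0 => xj; have := @cbrt_incr_ge x; rewrite /h; lra.
  by move: sE; rewrite {1}j0 big_geq// => -> ; lra.
have := exprn_ge0 3 hx.
have vE : x - j.-1%:R = v + 1.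
  by rewrite /v -{2}(prednK j0) -natr1; ring.
have head : 0 <= \sum_(0 <= k < j.-1) triple (x - k%:R).
  rewrite big_nat; apply: sumr_ge0 => k /andP[_ jk]; apply: triple_ge0.
  have kj : (k.+1 <= j)%N by rewrite (leq_trans jk)// leq_pred.
  move: kj; rewrite -(ler_nat R) => kj.
  by rewrite -natr1 in kj; rewrite ger0_norm; lra.
move: sE; rewrite -{1}(prednK j0) big_nat_recr//= vE => ->.
have v0 : 0 <= v by rewrite /v; lra.
have v1 : v <= 1 by rewrite /v; lra.
suff : 24^-1 * 24^-1 * (12^-1 * 12^-1 * 12^-1) <= triple (v + 1) by lra.
have h1 : 24^-1 <= h v by have := @cbrt_incr_ge v; rewrite /h; lra.
have h2 : 24^-1 <= h (v + 1) by have := @cbrt_incr_ge (v + 1); rewrite /h; lra.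
have h3 := half_incr_gap v0 v1.
by rewrite /triple addrK; apply: ler_pM => //; try lra; apply: ler_pM => //; lra.
Qed.

(** The signed cube root is nondecreasing, and its variation dominates that of the even
    one. *)
Lemma cbrt_dist_var x y : y <= x ->
  `|cbrt x - cbrt y| <= Num.sg x * cbrt x - Num.sg y * cbrt y.
Proof.
have cx := cbrt_ge0 x; have cy := cbrt_ge0 y => yx.
have [x0|x0] := leP x 0.
  have cxy : cbrt x <= cbrt y by apply: le_cbrt; rewrite !ler0_norm; lra.
  have -> : Num.sg x * cbrt x = - cbrt x.
    have [->|xn0] := eqVneq x 0; first by rewrite cbrt0 mulr0 oppr0.
    by rewrite ltr0_sg ?mulN1r// lt_neqAle xn0.
  have -> : Num.sg y * cbrt y = - cbrt y.
    have [->|yn0] := eqVneq y 0; first by rewrite cbrt0 mulr0 oppr0.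
    by rewrite ltr0_sg ?mulN1r// lt_neqAle yn0/= (le_trans yx).
  by rewrite ler_norml; apply/andP; split; lra.
rewrite gtr0_sg// mul1r.
have [y0|y0] := leP y 0.
  have -> : Num.sg y * cbrt y = - cbrt y.
    have [->|yn0] := eqVneq y 0; first by rewrite cbrt0 mulr0 oppr0.
    by rewrite ltr0_sg ?mulN1r// lt_neqAle yn0.
  by rewrite ler_norml; apply/andP; split; lra.
have cxy : cbrt y <= cbrt x by apply: le_cbrt; rewrite !ger0_norm; lra.
by rewrite gtr0_sg// mul1r ger0_norm// subr_ge0.
Qed.

Lemma sum_cbrt_grid x e N : 0 <= e ->
  \sum_(k < N) `|cbrt (x - k%:R * e) - cbrt (x - k.+1%:R * e)| <=
  cbrt x + cbrt (x - N%:R * e).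
Proof.
move=> e0; pose S y := Num.sg y * cbrt y.
apply: (@le_trans _ _ (S x - S (x - N%:R * e))); last first.
  have Sle y : `|S y| <= cbrt y.
    rewrite /S normrM (ger0_norm (cbrt_ge0 y)) normr_sg.
    by case: (y == 0); rewrite ?mul0r ?mul1r ?cbrt_ge0.
  have := Sle x; have := Sle (x - N%:R * e).
  by rewrite !ler_norml => /andP[? ?] /andP[? ?]; lra.
elim: N => [|N IH]; first by rewrite big_ord0 mul0r subr0 subrr.
rewrite big_ord_recr/=.
have := @cbrt_dist_var (x - N%:R * e) (x - N.+1%:R * e).
rewrite -/(S _) -/(S _) => /(_ _)/le_trans => H.
apply: (@le_trans _ _ ((S x - S (x - N%:R * e)) + (S (x - N%:R * e) - S (x - N.+1%:R * e)))); last by lra.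
apply: lerD => //; apply: cbrt_dist_var; rewrite lerD2l lerN2.
by rewrite ler_wpM2r// ler_nat.
Qed.

End increment_correlation.

(** * Random variables with finite moments of all orders *)

Section moments.
Context d (Omega : measurableType d) (R : realType) (P : probability Omega R).
Implicit Types (f g : Omega -> R) (n : nat).

Definition mean f : R := \int[P]_w f w.

(** This class is closed under sums and products, which turns the integrability of the
    polynomial expressions met below into a syntactic matter. *)
Definition has_moments f := measurable_fun setT f /\
  forall n, P.-integrable setT (fun w => (f w ^+ n)%:E).

Lemma has_moments_measurable f : has_moments f -> measurable_fun setT f.
Proof. by case. Qed.

Lemma has_moments_integrable f : has_moments f -> P.-integrable setT (EFin \o f).
Proof. by move=> [_ /(_ 1%N)]; apply: eq_integrable. Qed.

Lemma integrable_le f g : measurable_fun setT f -> P.-integrable setT (EFin \o g) ->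
  (forall w, `|f w| <= g w) -> P.-integrable setT (EFin \o f).
Proof.
move=> mf ig fg; apply: le_integrable ig => //; first exact/measurable_EFinP.
by move=> w _ /=; rewrite lee_fin (le_trans (fg w))// ler_norm.
Qed.

Lemma has_moments_le f g : measurable_fun setT f -> has_moments g ->
  (forall w, `|f w| <= g w) -> has_moments f.
Proof.
move=> mf [mg ig] fg; split=> // n.
apply: (@integrable_le (fun w => f w ^+ n) (fun w => g w ^+ n)) => //.
  exact: measurable_funX.
exact: ig.
by move=> w; rewrite normrX lerXn2r ?nnegrE// (le_trans _ (fg w)).
Qed.

Lemma has_moments_cst c : has_moments (cst c).
Proof.
split=> [|n]; first exact: measurable_cst.
exact: (@finite_measure_integrable_cst _ _ _ P setT (c ^+ n)).
Qed.

Lemma pow_le_double (x : R) n : `|x ^+ n| <= 1 + x ^+ (n * 2).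
Proof.
rewrite exprM; have := sqr_ge0 (`|x ^+ n| - 1).
have -> : x ^+ n ^+ 2 = `|x ^+ n| ^+ 2 by rewrite real_normK// num_real.
have := normr_ge0 (x ^+ n); set y := `|_|; nra.
Qed.

Lemma has_momentsM f g : has_moments f -> has_moments g ->
  has_moments (fun w => f w * g w).
Proof.
move=> [mf if_] [mg ig]; split=> [|n]; first exact: measurable_funM.
apply: (@integrable_le (fun w => (f w * g w) ^+ n)
    (fun w => f w ^+ (n * 2) + g w ^+ (n * 2))).
- by apply: measurable_funX; exact: measurable_funM.
- by apply: eq_integrable (integrableD _ (if_ (n * 2)%N) (ig (n * 2)%N)).
- move=> w; rewrite exprMn !exprM normrM.
  rewrite -[f w ^+ n ^+ 2]real_normK ?num_real// -[g w ^+ n ^+ 2]real_normK ?num_real//.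
  have := normr_ge0 (f w ^+ n); have := normr_ge0 (g w ^+ n).
  set y := `|_|; set x := `|_|; have := sqr_ge0 (x - y); nra.
Qed.

Lemma add_pow_le (x y : R) n :
  `|(x + y) ^+ n| <= 2 ^+ n * (2 + x ^+ (n * 2) + y ^+ (n * 2)).
Proof.
apply: (@le_trans _ _ (2 ^+ n * (`|x ^+ n| + `|y ^+ n|))); last first.
  rewrite ler_wpM2l ?exprn_ge0//.
  have := pow_le_double x n; have := pow_le_double y n; lra.
rewrite !normrX; wlog xy : x y / `|x| <= `|y|.
  move=> H; have [/H//|/ltW/H] := leP `|x| `|y|.
  by rewrite (addrC y) (addrC (`|y| ^+ n)).
apply: (@le_trans _ _ ((2 * `|y|) ^+ n)).
  by rewrite lerXn2r ?nnegrE ?mulr_ge0// (le_trans (ler_normD _ _))//; lra.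
by rewrite exprMn ler_wpM2l ?exprn_ge0// lerDr exprn_ge0.
Qed.

Lemma has_momentsD f g : has_moments f -> has_moments g ->
  has_moments (fun w => f w + g w).
Proof.
move=> [mf if_] [mg ig]; split=> [|n]; first exact: measurable_funD.
apply: (@integrable_le (fun w => (f w + g w) ^+ n)
    (fun w => 2 ^+ n * (2 + f w ^+ (n * 2) + g w ^+ (n * 2)))).
- by apply: measurable_funX; exact: measurable_funD.
- have i2 : P.-integrable setT (EFin \o cst (2 : R)).
    exact: finite_measure_integrable_cst.
  have := integrableD _ (integrableD _ i2 (if_ (n * 2)%N)) (ig (n * 2)%N).
  move=> /(_ measurableT measurableT) /(integrableZl measurableT (2 ^+ n)).
  by apply: eq_integrable.
- by move=> w; exact: add_pow_le.
Qed.

Lemma has_momentsZ c f : has_moments f -> has_moments (fun w => c * f w).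
Proof. by move=> mf; apply: has_momentsM => //; exact: has_moments_cst. Qed.

Lemma has_momentsB f g : has_moments f -> has_moments g ->
  has_moments (fun w => f w - g w).
Proof.
move=> mf mg; rewrite (_ : (fun _ => _) = fun w => f w + (-1) * g w).
  by apply: has_momentsD => //; exact: has_momentsZ.
by apply/funext => w; rewrite mulN1r.
Qed.

Lemma has_momentsX n f : has_moments f -> has_moments (fun w => f w ^+ n).
Proof.
move=> mf; elim: n => [|n IH].
  by rewrite (_ : (fun _ => _) = cst 1)//; exact: has_moments_cst.
rewrite (_ : (fun _ => _) = fun w => f w * f w ^+ n); first exact: has_momentsM.
by apply/funext => w; rewrite exprS.
Qed.

Lemma has_moments_sum I (s : seq I) (F : I -> Omega -> R) :
  (forall i, has_moments (F i)) -> has_moments (fun w => \sum_(i <- s) F i w).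
Proof.
move=> mF; elim: s => [|i s IH].
  rewrite (_ : (fun _ => _) = cst 0); first exact: has_moments_cst.
  by apply/funext => w; rewrite big_nil.
rewrite (_ : (fun _ => _) = fun w => F i w + \sum_(i <- s) F i w).
  exact: has_momentsD.
by apply/funext => w; rewrite big_cons.
Qed.

Lemma mean_cst c : mean (cst c) = c.
Proof. rewrite /mean (Rintegral_cst P measurableT). rewrite [X in fine X]probability_setT/= mulr1//. Qed.

Lemma meanD f g : has_moments f -> has_moments g ->
  mean (fun w => f w + g w) = mean f + mean g.
Proof.
by move=> mf mg; rewrite /mean RintegralD//; exact: has_moments_integrable.
Qed.

Lemma meanB f g : has_moments f -> has_moments g ->
  mean (fun w => f w - g w) = mean f - mean g.
Proof.
by move=> mf mg; rewrite /mean RintegralB//; exact: has_moments_integrable.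
Qed.

Lemma meanZ c f : has_moments f -> mean (fun w => c * f w) = c * mean f.
Proof. by move=> mf; rewrite /mean RintegralZl//; exact: has_moments_integrable. Qed.

Lemma mean_sum I (s : seq I) (F : I -> Omega -> R) :
  (forall i, has_moments (F i)) ->
  mean (fun w => \sum_(i <- s) F i w) = \sum_(i <- s) mean (F i).
Proof.
move=> mF; elim: s => [|i s IH].
  by rewrite big_nil -[RHS]mean_cst; congr mean; apply/funext => w; rewrite big_nil.
rewrite big_cons -IH -meanD//; last exact: has_moments_sum.
by congr mean; apply/funext => w; rewrite big_cons.
Qed.

Lemma le_mean f g : P.-integrable setT (EFin \o f) -> P.-integrable setT (EFin \o g) ->
  (forall w, f w <= g w) -> mean f <= mean g.
Proof. by move=> mf mg fg; apply: le_Rintegral. Qed.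

Lemma mean_ge0 f : (forall w, 0 <= f w) -> 0 <= mean f.
Proof. by move=> f0; apply: Rintegral_ge0. Qed.

Lemma le_norm_mean f : has_moments f -> `|mean f| <= mean (fun w => `|f w|).
Proof.
by move=> mf; apply: le_normr_Rintegral => //; exact: has_moments_integrable.
Qed.

Lemma has_moments_norm f : has_moments f -> has_moments (fun w => `|f w|).
Proof.
move=> mf; apply: (@has_moments_le _ (fun w => 1 + f w ^+ 2)).
- by apply: measurableT_comp => //; case: mf.
- apply: has_momentsD; last exact: has_momentsX.
  exact: has_moments_cst.
- by move=> w; rewrite normr_id; have := pow_le_double (f w) 1; rewrite expr1.
Qed.

End moments.

(** * Taylor bounds for the exponential *)

Section exponential_taylor.
Context {R : realType}.
Implicit Types x u : R.

Lemma series_exp_coeff_le x n : 0 <= x -> series (exp_coeff x) n <= expR x.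
Proof.
move=> x0; apply: nondecreasing_cvgn_le; last exact: is_cvg_series_exp_coeff.
by apply: nondecreasing_series => k _ _; rewrite /exp_coeff divr_ge0 ?exprn_ge0.
Qed.

(** Since [(n + j)! >= j!], the remainder is termwise at most [|x| ^ n] times the series of
    [expR |x|]. *)
Lemma expR_taylor n x :
  `|expR x - \sum_(0 <= i < n) x ^+ i / i`!%:R| <= `|x| ^+ n * expR `|x|.
Proof.
set s := \sum_(0 <= i < n) _.
have bound j : `|series (exp_coeff x) (n + j)%N - s| <= `|x| ^+ n * expR `|x|.
  apply: (@le_trans _ _ (`|x| ^+ n * series (exp_coeff `|x|) j)); last first.
    by rewrite ler_wpM2l ?exprn_ge0// series_exp_coeff_le.
  elim: j => [|j IH].
    by rewrite addn0 subrr normr0 mulr_ge0 ?exprn_ge0// /series/= big_geq.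
  rewrite addnS !seriesSr addrAC mulrDr.
  apply: le_trans (ler_normD _ _) _; apply: lerD => //.
  rewrite /exp_coeff normrM normfV normrX exprD mulrA (ger0_norm (ler0n _ _)).
  by rewrite ler_wpM2l ?mulr_ge0 ?exprn_ge0// lef_pV2 ?posrE ?ltr0n ?fact_gt0//
    ler_nat leq_fact// leq_addl.
have cs : series (exp_coeff x) (n + j)%N - s @[j --> \oo] --> expR x - s.
  apply: cvgB; last exact: cvg_cst.
  have h := is_cvg_series_exp_coeff x; rewrite -(cvg_shiftn n) in h.
  by under eq_fun do rewrite addnC.
have cn : `|series (exp_coeff x) (n + j)%N - s| @[j --> \oo] --> `|expR x - s|.
  exact: cvg_norm.
rewrite -(cvg_lim _ cn)//; apply: limr_le; first exact: cvgP cn.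
near=> j; exact: bound.
Unshelve. all: by end_near.
Qed.

Lemma expR_norm_le x : expR `|x| <= expR x + expR (- x).
Proof.
have [x0|x0] := leP 0 x; first by rewrite ger0_norm// lerDl expR_ge0.
by rewrite ltr0_norm// lerDr expR_ge0.
Qed.

Lemma norm_le_expR x : `|x| <= expR x + expR (- x).
Proof.
by apply: le_trans (expR_norm_le x); have := expR_ge1Dx `|x|; lra.
Qed.

Lemma expR_taylor4 x :
  `|expR x - (1 + x + x ^+ 2 / 2 + x ^+ 3 / 6)| <= `|x| ^+ 4 * expR `|x|.
Proof.
have := expR_taylor 4 x; congr (`|_ - _| <= _).
rewrite !big_nat_recr//= big_geq//= !factS fact0 expr0 expr1.
by rewrite add0r !muln1 divr1 divr1.
Qed.

(** The exponent is that of the generating function of Gaussian variables; its expansion to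
    third order gives their joint moments through [mean_cubic_coeffs]. *)
Lemma expR_quadratic_taylor (a b : R) : exists K, forall u, 0 <= u -> u <= 1 ->
  `|expR (a * u + b * u ^+ 2) - (1 + a * u + (b + a ^+ 2 / 2) * u ^+ 2 +
    (a * b + a ^+ 3 / 6) * u ^+ 3)| <= K * u ^+ 4.
Proof.
pose M := `|a| + `|b|.
exists (M ^+ 4 * expR M + (`|b ^+ 2 / 2 + a ^+ 2 * b / 2| + `|a * b ^+ 2 / 2| + `|b ^+ 3 / 6|)).
move=> u u0 u1; set x := a * u + b * u ^+ 2.
have xM : `|x| <= u * M.
  rewrite /x /M mulrDr (le_trans (ler_normD _ _))// !normrM (ger0_norm u0).
  by rewrite [`|a| * u]mulrC lerD2l [leLHS]mulrC ler_wpM2r// ler_piMl.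
have M0 : 0 <= M by rewrite addr_ge0 ?normr_ge0.
have e : expR x - (1 + a * u + (b + a ^+ 2 / 2) * u ^+ 2 +
    (a * b + a ^+ 3 / 6) * u ^+ 3) =
  (expR x - (1 + x + x ^+ 2 / 2 + x ^+ 3 / 6)) +
  (b ^+ 2 / 2 + a ^+ 2 * b / 2 + a * b ^+ 2 / 2 * u + b ^+ 3 / 6 * u ^+ 2) * u ^+ 4.
  by rewrite /x; field.
rewrite e [leRHS]mulrDl; apply: le_trans (ler_normD _ _) (lerD _ _).
  apply: le_trans (expR_taylor4 x) _; rewrite [leRHS]mulrC mulrA -exprMn.
  apply: ler_pM; rewrite ?exprn_ge0 ?expR_ge0//.
    by apply: lerXn2r; rewrite ?nnegrE ?mulr_ge0.
  by rewrite ler_expR (le_trans xM)// ler_piMl.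
rewrite normrM (ger0_norm (exprn_ge0 4 u0)) ler_wpM2r ?exprn_ge0//.
apply: le_trans (ler_normD _ _) (lerD _ _).
  rewrite (le_trans (ler_normD _ _))// lerD2l normrM (ger0_norm u0).
  by rewrite ler_piMr.
by rewrite normrM (ger0_norm (exprn_ge0 2 u0)) ler_piMr// exprn_ile1.
Qed.

Lemma le_small_eq0 (c M : R) : (forall u, 0 < u -> u <= 1 -> `|c| <= M * u) -> c = 0.
Proof.
move=> H; apply/eqP; rewrite -normr_eq0 eq_le normr_ge0 andbT leNgt.
apply/negP => c0.
have M0 : 0 < M by have := H 1 ltr01 (lexx 1); rewrite mulr1; exact: lt_le_trans.
have := H (Num.min 1 (`|c| / (2 * M))).
rewrite lt_min ltr01 divr_gt0 ?mulr_gt0//= ge_min lexx => /(_ isT isT).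
apply/negP; rewrite -ltNge.
apply: (@le_lt_trans _ _ (M * (`|c| / (2 * M)))).
  by rewrite ler_wpM2l ?(ltW M0)// ge_min lexx orbT.
by rewrite invfM mulrCA mulrA mulrACA divff ?gt_eqF// mulr1; lra.
Qed.

Lemma head_coeff_eq0 (c M K : R) (r : R -> R) :
  (forall u, 0 < u -> u <= 1 -> `|r u| <= M) ->
  (forall u, 0 < u -> u <= 1 -> `|c + r u * u| <= K * u) -> c = 0.
Proof.
move=> rM H; apply: (@le_small_eq0 _ (K + M)) => u u0 u1.
rewrite -[c](addrK (r u * u)) (le_trans (ler_normB _ _))// mulrDl lerD ?H//.
by rewrite normrM (gtr0_norm u0) ler_wpM2r ?(ltW u0) ?rM.
Qed.

(** Uniqueness of third order expansions at [0]: the coefficients are killed one after the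
    other by dividing by [u]. *)
Lemma cubic_coeff_eq0 (c0 c1 c2 c3 K : R) :
  (forall u, 0 <= u -> u <= 1 ->
     `|c0 + c1 * u + c2 * u ^+ 2 + c3 * u ^+ 3| <= K * u ^+ 4) ->
  [/\ c0 = 0, c1 = 0, c2 = 0 & c3 = 0].
Proof.
move=> H.
have K0 : 0 <= K.
  by have := H 1 ler01 (lexx 1); rewrite !expr1n !mulr1; exact: le_trans.
have bnd2 (c c' u : R) : 0 < u -> u <= 1 -> `|c + c' * u| <= `|c| + `|c'|.
  move=> u0 u1; rewrite (le_trans (ler_normD _ _))// lerD2l normrM (gtr0_norm u0).
  by rewrite ler_piMr.
have Kle u n : 0 < u -> u <= 1 -> K * u ^+ n.+1 <= K * u.
  move=> u0 u1; rewrite ler_wpM2l// exprS ler_piMr ?(ltW u0)//.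
  by rewrite exprn_ile1// ltW.
have divu u n (c : R) : 0 < u -> `|u ^+ n * c| <= u ^+ n * (K * u ^+ (4 - n)) ->
    `|c| <= K * u ^+ (4 - n).
  move=> u0; rewrite normrM (gtr0_norm (exprn_gt0 n u0)).
  by rewrite ler_pM2l// exprn_gt0.
have e0 : c0 = 0.
  have := H 0 (lexx 0) ler01; rewrite !expr0n/= !mulr0 !addr0.
  by rewrite normr_le0 => /eqP.
have e1 : c1 = 0.
  apply: (@head_coeff_eq0 _ (`|c2| + `|c3|) K (fun u => c2 + c3 * u)) => u u0 u1.
    exact: bnd2.
  apply: le_trans (Kle u 2%N u0 u1); apply: (divu u 1%N) => //.
  have := H u (ltW u0) u1; rewrite e0; congr (`|_| <= _); ring.
have e2 : c2 = 0.
  apply: (@head_coeff_eq0 _ `|c3| K (fun u => c3)) => u u0 u1 //.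
  apply: le_trans (Kle u 1%N u0 u1); apply: (divu u 2%N) => //.
  have := H u (ltW u0) u1; rewrite e0 e1; congr (`|_| <= _); ring.
split=> //; apply: (@head_coeff_eq0 _ 0 K (fun=> 0)) => u u0 u1; first by rewrite normr0.
apply: le_trans (Kle u 0%N u0 u1); apply: (divu u 3%N) => //.
have := H u (ltW u0) u1; rewrite e0 e1 e2; congr (`|_| <= _); ring.
Qed.

End exponential_taylor.

(** * Centred Gaussian spaces *)

Section gaussian_spaces.
Context d (Omega : measurableType d) (R : realType) (P : probability Omega R).
Implicit Types (f g A B : Omega -> R) (G : set (Omega -> R)).
Local Notation mean := (mean P).
Local Notation has_moments := (has_moments P).

(** The moments [E[A ^ k B]] for [k <= 3] are the coefficients of the expansion of
    [u |-> E[exp (u A) B]] at [0]. Reading them off an expansion with a remainder replaces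
    differentiation under the expectation. *)
Lemma mean_cubic_coeffs A B (c0 c1 c2 c3 K : R) :
  has_moments A -> has_moments B ->
  (forall u, has_moments (fun w => expR (u * A w))) ->
  (forall u, 0 <= u -> u <= 1 ->
    `|mean (fun w => expR (u * A w) * B w) -
      (c0 + c1 * u + c2 * u ^+ 2 + c3 * u ^+ 3)| <= K * u ^+ 4) ->
  [/\ mean B = c0, mean (fun w => A w * B w) = c1,
      mean (fun w => A w ^+ 2 * B w) = 2 * c2 &
      mean (fun w => A w ^+ 3 * B w) = 6 * c3].
Proof.
move=> mA mB mexp H.
pose E n := mean (fun w => A w ^+ n * B w).
have mAB n : has_moments (fun w => A w ^+ n * B w).
  by apply: has_momentsM => //; exact: has_momentsX.
(* [D] dominates the Taylor remainder of [expR (u * A) * B], up to the factor [u ^+ 4], for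
   all [u] in [0, 1] at once. *)
pose D w := A w ^+ 4 * (expR (1 * A w) + expR (-1 * A w)) * (1 + B w ^+ 2).
have mD : has_moments D.
  apply: has_momentsM; first apply: has_momentsM; first exact: has_momentsX.
    exact: has_momentsD.
  by apply: has_momentsD; [exact: has_moments_cst|exact: has_momentsX].
have tayl u : 0 <= u -> u <= 1 ->
    `|mean (fun w => expR (u * A w) * B w) -
     (E 0%N + E 1%N * u + E 2%N / 2 * u ^+ 2 + E 3%N / 6 * u ^+ 3)| <= mean D * u ^+ 4.
  move=> u0 u1.
  pose T w := B w + u * (A w * B w) + u ^+ 2 / 2 * (A w ^+ 2 * B w) +
     u ^+ 3 / 6 * (A w ^+ 3 * B w).
  have mAB1 : has_moments (fun w => A w * B w) by exact: has_momentsM.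
  have mT3 : has_moments (fun w => B w + u * (A w * B w)).
    by apply: has_momentsD => //; exact: has_momentsZ.
  have mT2 : has_moments (fun w => B w + u * (A w * B w) + u ^+ 2 / 2 * (A w ^+ 2 * B w)).
    by apply: has_momentsD => //; exact: has_momentsZ.
  have mT : has_moments T by apply: has_momentsD => //; exact: has_momentsZ.
  have meT : mean T = E 0%N + E 1%N * u + E 2%N / 2 * u ^+ 2 + E 3%N / 6 * u ^+ 3.
    rewrite /T meanD//; last exact: has_momentsZ.
    rewrite meanD//; last exact: has_momentsZ.
    rewrite meanD//; last exact: has_momentsZ.
    rewrite !meanZ// /E.
    have -> : (fun w => A w ^+ 0 * B w) = B by apply/funext => w; rewrite expr0 mul1r.
    have -> : (fun w => A w ^+ 1 * B w) = fun w => A w * B w.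
      by apply/funext => w; rewrite expr1.
    by field.
  have mexpB : has_moments (fun w => expR (u * A w) * B w) by exact: has_momentsM.
  rewrite -meT -meanB//.
  have mdiff : has_moments (fun w => expR (u * A w) * B w - T w) by exact: has_momentsB.
  apply: le_trans (le_norm_mean mdiff) _.
  rewrite mulrC -meanZ//; apply: le_mean.
  - by apply: has_moments_integrable; exact: has_moments_norm.
  - by apply: has_moments_integrable; exact: has_momentsZ.
  move=> w; have -> : expR (u * A w) * B w - T w = (expR (u * A w) -
    (1 + u * A w + (u * A w) ^+ 2 / 2 + (u * A w) ^+ 3 / 6)) * B w.
    by rewrite /T; field.
  rewrite normrM /D mul1r mulN1r mulrA mulrA.
  apply: ler_pM => //; last by have := pow_le_double (B w) 1; rewrite expr1.
  apply: le_trans (expR_taylor4 _) _.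
  rewrite normrM exprMn (ger0_norm u0).
  have A4 : 0 <= A w ^+ 4 by exact: exprn_even_ge0.
  have -> : `|A w| ^+ 4 = A w ^+ 4 by rewrite -normrX ger0_norm.
  apply: ler_wpM2l; first by apply: mulr_ge0 => //; exact: exprn_ge0.
  by apply: le_trans (expR_norm_le _); rewrite ler_expR ler_piMl.
have [] := @cubic_coeff_eq0 _ (E 0%N - c0) (E 1%N - c1) (E 2%N / 2 - c2) (E 3%N / 6 - c3)
  (mean D + K).
  move=> u u0 u1; have := tayl u u0 u1; have := H u u0 u1.
  rewrite !ler_norml => /andP[? ?] /andP[? ?]; apply/andP; split; lra.
rewrite /E.
have -> : (fun w => A w ^+ 0 * B w) = B by apply/funext => w; rewrite expr0 mul1r.
have -> : (fun w => A w ^+ 1 * B w) = fun w => A w * B w.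
  by apply/funext => w; rewrite expr1.
by move=> ? ? ? ?; split; lra.
Qed.

(** A vector space of centred Gaussian variables, described through Laplace transforms, from
    which all joint moments used below are derived. *)
Record gaussian_space G : Prop := {
  gaussian_space_measurable : forall f, G f -> measurable_fun setT f ;
  gaussian_space_lin : forall f g (a b : R), G f -> G g ->
    G (fun w => a * f w + b * g w) ;
  gaussian_space_mgf : forall f, G f ->
    (\int[P]_w (expR (f w))%:E = (expR (mean (fun w => f w ^+ 2) / 2))%:E)%E }.

Section theory.
Context G (hG : gaussian_space G).

Lemma gaussian_scale f c : G f -> G (fun w => c * f w).
Proof.
move=> Gf; have := gaussian_space_lin hG c 0 Gf Gf.
by congr G; apply/funext => w; rewrite mul0r addr0.
Qed.

Lemma gaussian_expR_moments f : G f -> has_moments (fun w => expR (f w)).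
Proof.
move=> Gf; have mf := gaussian_space_measurable hG Gf.
split=> [|n]; first exact: measurableT_comp.
have Gn := gaussian_scale n%:R Gf.
have eE : (fun w => (expR (f w) ^+ n)%:E) = (fun w => (expR (n%:R * f w))%:E).
  by apply/funext => w; rewrite expRM_natl.
rewrite eE; apply/integrableP; split.
  apply/measurable_EFinP; apply: measurableT_comp => //.
  exact: (gaussian_space_measurable hG Gn).
under eq_integral do rewrite /= ger0_norm ?expR_ge0//.
by rewrite (gaussian_space_mgf hG Gn) ltry.
Qed.

Lemma gaussian_expR_scale_moments f u : G f -> has_moments (fun w => expR (u * f w)).
Proof. by move=> Gf; apply: (@gaussian_expR_moments (fun w => u * f w)); exact: gaussian_scale. Qed.

Lemma gaussian_has_moments f : G f -> has_moments f.
Proof.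
move=> Gf; apply: (@has_moments_le _ _ _ _ _ (fun w => expR (f w) + expR (-1 * f w))).
- exact: (gaussian_space_measurable hG Gf).
- by apply: has_momentsD; [exact: gaussian_expR_moments|exact: gaussian_expR_scale_moments].
- by move=> w; rewrite mulN1r; exact: norm_le_expR.
Qed.

Lemma gaussian_mgf f : G f -> mean (fun w => expR (f w)) = expR (mean (fun w => f w ^+ 2) / 2).
Proof. by move=> Gf; rewrite /mean /Rintegral (gaussian_space_mgf hG Gf). Qed.

Lemma mean_sqr_lin a b (u v : R) : has_moments a -> has_moments b ->
  mean (fun w => (u * a w + v * b w) ^+ 2) =
  u ^+ 2 * mean (fun w => a w ^+ 2) + 2 * (u * v) * mean (fun w => a w * b w) +
  v ^+ 2 * mean (fun w => b w ^+ 2).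
Proof.
move=> ma mb; rewrite -!meanZ; try by [apply: has_momentsX|apply: has_momentsM].
have m1 : has_moments (fun w => u ^+ 2 * a w ^+ 2) by apply/has_momentsZ/has_momentsX.
have m2 : has_moments (fun w => 2 * (u * v) * (a w * b w)) by apply/has_momentsZ/has_momentsM.
have m3 : has_moments (fun w => v ^+ 2 * b w ^+ 2) by apply/has_momentsZ/has_momentsX.
rewrite -meanD// -meanD//; last exact: has_momentsD.
by congr mean; apply/funext => w; ring.
Qed.

(** The generating function [E[exp (u a + v b)]] is the exponential of half the variance of
    [u a + v b]; the third moment in [a] is its third coefficient in [u]. *)
Lemma mean_cube_expR a b (v : R) : G a -> G b ->
  mean (fun w => a w ^+ 3 * expR (v * b w)) =
  expR (v ^+ 2 * mean (fun w => b w ^+ 2) / 2) *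
   (3 * mean (fun w => a w ^+ 2) * (v * mean (fun w => a w * b w)) +
    (v * mean (fun w => a w * b w)) ^+ 3).
Proof.
move=> Ga Gb; have ma := gaussian_has_moments Ga; have mb := gaussian_has_moments Gb.
set s := mean (fun w => a w ^+ 2); set t := mean (fun w => b w ^+ 2).
set r := mean (fun w => a w * b w); set e := expR _.
have [K HK] := expR_quadratic_taylor (v * r) (s / 2).
have e0 : 0 <= e by exact: expR_ge0.
have [] := @mean_cubic_coeffs a (fun w => expR (v * b w)) e (e * (v * r))
  (e * (s / 2 + (v * r) ^+ 2 / 2)) (e * (v * r * (s / 2) + (v * r) ^+ 3 / 6)) (e * K) ma.
- exact: gaussian_expR_scale_moments.
- by move=> u; exact: gaussian_expR_scale_moments.
- move=> u u0 u1.
  have -> : mean (fun w => expR (u * a w) * expR (v * b w)) =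
      e * expR (v * r * u + s / 2 * u ^+ 2).
    have -> : (fun w => expR (u * a w) * expR (v * b w)) =
        fun w => expR (u * a w + v * b w) by apply/funext => w; rewrite expRD.
    rewrite gaussian_mgf ?mean_sqr_lin//; last exact: (gaussian_space_lin hG).
    rewrite -/s -/t -/r /e -expRD; congr expR; by field.
  have -> : forall x : R, e * x - (e + e * (v * r) * u + e * (s / 2 + (v * r) ^+ 2 / 2) * u ^+ 2 +
     e * (v * r * (s / 2) + (v * r) ^+ 3 / 6) * u ^+ 3) =
     e * (x - (1 + v * r * u + (s / 2 + (v * r) ^+ 2 / 2) * u ^+ 2 +
      (v * r * (s / 2) + (v * r) ^+ 3 / 6) * u ^+ 3)) by move=> x; ring.
  by rewrite normrM (ger0_norm e0) -[leRHS]mulrA ler_wpM2l// HK.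
- by move=> _ _ _ ->; field.
Qed.

Definition sinhR (x : R) := (expR x - expR (- x)) / 2.

Lemma gaussian_sinh_moments b : G b -> has_moments (fun w => sinhR (b w)).
Proof.
move=> Gb; have -> : (fun w => sinhR (b w)) =
    fun w => 2^-1 * (expR (1 * b w) - expR (-1 * b w)).
  by apply/funext => w; rewrite /sinhR mul1r mulN1r mulrC.
by apply/has_momentsZ/has_momentsB; exact: gaussian_expR_scale_moments.
Qed.

(** The exponential moments at [b] and at [- b] are opposite, so both halves of the
    hyperbolic sine contribute the same amount. *)
Lemma mean_cube_sinh a b : G a -> G b ->
  mean (fun w => a w ^+ 3 * sinhR (b w)) =
  expR (mean (fun w => b w ^+ 2) / 2) *
   (3 * mean (fun w => a w ^+ 2) * mean (fun w => a w * b w) +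
    mean (fun w => a w * b w) ^+ 3).
Proof.
move=> Ga Gb; have ma3 := has_momentsX 3 (gaussian_has_moments Ga).
have -> : (fun w => a w ^+ 3 * sinhR (b w)) =
    fun w => 2^-1 * (a w ^+ 3 * expR (1 * b w) - a w ^+ 3 * expR (-1 * b w)).
  by apply/funext => w; rewrite /sinhR mul1r mulN1r; field.
have m u : has_moments (fun w => a w ^+ 3 * expR (u * b w)).
  by apply: has_momentsM => //; exact: gaussian_expR_scale_moments.
rewrite meanZ; last exact: has_momentsB.
rewrite meanB// !mean_cube_expR// sqrrN expr1n !mul1r.
by field.
Qed.

(** The third coefficient in [u] of [mean_cube_expR] at [v = u]. *)
Lemma mean_cube_cube a b : G a -> G b ->
  mean (fun w => a w ^+ 3 * b w ^+ 3) =
  9 * mean (fun w => a w ^+ 2) * mean (fun w => b w ^+ 2) * mean (fun w => a w * b w) +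
  6 * mean (fun w => a w * b w) ^+ 3.
Proof.
move=> Ga Gb; have ma := gaussian_has_moments Ga; have mb := gaussian_has_moments Gb.
set s := mean (fun w => a w ^+ 2); set t := mean (fun w => b w ^+ 2).
set r := mean (fun w => a w * b w).
have [K HK] := expR_quadratic_taylor 0 (t / 2).
have [] := @mean_cubic_coeffs b (fun w => a w ^+ 3) 0 (3 * s * r) 0
    (3 * s * r * (t / 2) + r ^+ 3) (`|3 * s * r| * K + `|r ^+ 3| * (K + `|t / 2|)) mb.
- exact: has_momentsX.
- by move=> u; exact: gaussian_expR_scale_moments.
- move=> u u0 u1.
  have -> : (fun w => expR (u * b w) * a w ^+ 3) = fun w => a w ^+ 3 * expR (u * b w).
    by apply/funext => w; rewrite mulrC.
  rewrite mean_cube_expR// -/s -/t -/r.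
  have -> : u ^+ 2 * t / 2 = t / 2 * u ^+ 2 by field.
  pose D := expR (t / 2 * u ^+ 2) - (1 + t / 2 * u ^+ 2).
  have HKu : `|D| <= K * u ^+ 4.
    by have := HK u u0 u1; rewrite /D mul0r add0r; congr (`|_ - _| <= _); field.
  have -> : expR (t / 2 * u ^+ 2) * (3 * s * (u * r) + (u * r) ^+ 3) -
      (0 + 3 * s * r * u + 0 * u ^+ 2 + (3 * s * r * (t / 2) + r ^+ 3) * u ^+ 3) =
     3 * s * r * (u * D) + r ^+ 3 * (u ^+ 3 * (D + t / 2 * u ^+ 2)).
    by rewrite /D; ring.
  have u3 : 0 <= u ^+ 3 by exact: exprn_ge0.
  have u4 : 0 <= u ^+ 4 by exact: exprn_ge0.
  have K0 : 0 <= K * u ^+ 4 := le_trans (normr_ge0 _) HKu.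
  rewrite [leRHS]mulrDl; apply: le_trans (ler_normD _ _) (lerD _ _).
    rewrite normrM -[leRHS]mulrA ler_wpM2l// normrM (ger0_norm u0).
    by rewrite (le_trans _ HKu)// ler_piMl.
  rewrite normrM -[leRHS]mulrA ler_wpM2l// normrM (ger0_norm u3) [leRHS]mulrDl.
  rewrite (le_trans (ler_wpM2l u3 (ler_normD _ _)))// [leLHS]mulrDr lerD//.
    by rewrite (le_trans _ HKu)// ler_piMl// exprn_ile1.
  rewrite normrM (ger0_norm (exprn_ge0 2 u0)) mulrCA ler_wpM2l// -exprD.
  by rewrite exprS ler_piMl.
- move=> _ _ _ e.
  have -> : (fun w => a w ^+ 3 * b w ^+ 3) = fun w => b w ^+ 3 * a w ^+ 3.
    by apply/funext => w; rewrite mulrC.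
  by rewrite e; field.
Qed.

End theory.
End gaussian_spaces.

(** * Fourth moment of a sum of hyperbolic sines *)

Section sinh_fourth_moment.
Context d (Omega : measurableType d) (R : realType) (P : probability Omega R).
Context (G : set (Omega -> R)) (hG : gaussian_space P G).
Local Notation mean := (mean P).
Local Notation has_moments := (has_moments P).

Definition coshR (x : R) := (expR x + expR (- x)) / 2.

Definition sign_diff (f : R -> R) := f 1 - f (-1).

Lemma coshR_sinhR (x : R) : expR x = coshR x + sinhR x.
Proof. by rewrite /coshR /sinhR; field. Qed.

Lemma coshR_sinhRN (x : R) : expR (- x) = coshR x - sinhR x.
Proof. by rewrite /coshR /sinhR; field. Qed.

(** Expand the product of the four hyperbolic sines into 16 exponentials
    [expR (s1 a1 + s2 a2 + s3 a3 + s4 a4)] with signs [si] and weight [s1 s2 s3 s4 / 16].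
    The mean of such an exponential is [expR 2] times the product over the pairs [i < j] of
    [expR (si sj rij) = cij + si sj sij], where [cij] and [sij] are hyperbolic cosines and
    sines. Summation over the signs keeps the choices of pairs that cover every index an
    odd number of times. As sets of edges of the complete graph on four vertices these are
    the three perfect matchings, the four stars and the whole graph. *)
Lemma mean_sinh4 a1 a2 a3 a4 (r12 r13 r14 r23 r24 r34 : R) :
  G a1 -> G a2 -> G a3 -> G a4 ->
  mean (fun w => a1 w ^+ 2) = 1 -> mean (fun w => a2 w ^+ 2) = 1 ->
  mean (fun w => a3 w ^+ 2) = 1 -> mean (fun w => a4 w ^+ 2) = 1 ->
  mean (fun w => a1 w * a2 w) = r12 -> mean (fun w => a1 w * a3 w) = r13 ->
  mean (fun w => a1 w * a4 w) = r14 -> mean (fun w => a2 w * a3 w) = r23 ->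
  mean (fun w => a2 w * a4 w) = r24 -> mean (fun w => a3 w * a4 w) = r34 ->
  mean (fun w => sinhR (a1 w) * sinhR (a2 w) * sinhR (a3 w) * sinhR (a4 w)) =
  let s12 := sinhR r12 in let s13 := sinhR r13 in let s14 := sinhR r14 in
  let s23 := sinhR r23 in let s24 := sinhR r24 in let s34 := sinhR r34 in
  let c12 := coshR r12 in let c13 := coshR r13 in let c14 := coshR r14 in
  let c23 := coshR r23 in let c24 := coshR r24 in let c34 := coshR r34 in
  expR 2 * (s12 * s34 * c13 * c14 * c23 * c24 + s13 * s24 * c12 * c14 * c23 * c34 +
            s14 * s23 * c12 * c13 * c24 * c34 +
            s12 * s13 * s14 * c23 * c24 * c34 + s12 * s23 * s24 * c13 * c14 * c34 +
            s13 * s23 * s34 * c12 * c14 * c24 + s14 * s24 * s34 * c12 * c13 * c23 +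
            s12 * s13 * s14 * s23 * s24 * s34).
Proof.
move=> G1 G2 G3 G4 v1 v2 v3 v4 e12 e13 e14 e23 e24 e34.
pose L s1 s2 s3 s4 w := 1 * (s1 * a1 w + s2 * a2 w) + 1 * (s3 * a3 w + s4 * a4 w).
have G12 s1 s2 : G (fun w => s1 * a1 w + s2 * a2 w) by exact: (gaussian_space_lin hG).
have G34 s3 s4 : G (fun w => s3 * a3 w + s4 * a4 w) by exact: (gaussian_space_lin hG).
have GL s1 s2 s3 s4 : G (L s1 s2 s3 s4) by exact: (gaussian_space_lin hG).
have mL s1 s2 s3 s4 : has_moments (fun w => expR (L s1 s2 s3 s4 w)).
  exact: (gaussian_expR_moments hG).
have -> : (fun w => sinhR (a1 w) * sinhR (a2 w) * sinhR (a3 w) * sinhR (a4 w)) =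
  fun w => 16^-1 * sign_diff (fun s1 => sign_diff (fun s2 => sign_diff (fun s3 =>
     sign_diff (fun s4 => expR (L s1 s2 s3 s4 w))))).
  apply/funext => w; rewrite /sign_diff /L /sinhR !mul1r !mulN1r !expRD.
  by field.
have M s1 s2 s3 s4 : s1 ^+ 2 = 1 -> s2 ^+ 2 = 1 -> s3 ^+ 2 = 1 -> s4 ^+ 2 = 1 ->
    mean (fun w => expR (L s1 s2 s3 s4 w)) = expR 2 * (expR (s1 * s2 * r12) *
      expR (s1 * s3 * r13) * expR (s1 * s4 * r14) * expR (s2 * s3 * r23) *
      expR (s2 * s4 * r24) * expR (s3 * s4 * r34)).
  move=> q1 q2 q3 q4.
  have m1 := gaussian_has_moments hG G1; have m2 := gaussian_has_moments hG G2.
  have m3 := gaussian_has_moments hG G3; have m4 := gaussian_has_moments hG G4.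
  rewrite (gaussian_mgf hG)// (mean_sqr_lin _ _ (gaussian_has_moments hG (G12 _ _))
    (gaussian_has_moments hG (G34 _ _))) !mean_sqr_lin// v1 v2 v3 v4 e12 e34 q1 q2 q3 q4.
  have -> : mean (fun w => (s1 * a1 w + s2 * a2 w) * (s3 * a3 w + s4 * a4 w)) =
      s1 * s3 * r13 + s1 * s4 * r14 + s2 * s3 * r23 + s2 * s4 * r24.
    rewrite -e13 -e14 -e23 -e24.
    have m13 : has_moments (fun w => s1 * s3 * (a1 w * a3 w)).
      by apply: has_momentsZ; exact: has_momentsM.
    have m14 : has_moments (fun w => s1 * s4 * (a1 w * a4 w)).
      by apply: has_momentsZ; exact: has_momentsM.
    have m23 : has_moments (fun w => s2 * s3 * (a2 w * a3 w)).
      by apply: has_momentsZ; exact: has_momentsM.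
    have m24 : has_moments (fun w => s2 * s4 * (a2 w * a4 w)).
      by apply: has_momentsZ; exact: has_momentsM.
    rewrite -!meanZ; try exact: has_momentsM.
    rewrite -meanD// -meanD//; last exact: has_momentsD.
    rewrite -meanD//; last by apply: has_momentsD => //; exact: has_momentsD.
    by congr mean; apply/funext => w; ring.
  by rewrite -!expRD; congr expR; field.
rewrite meanZ; last first.
  by rewrite /sign_diff; do ?apply: has_momentsB.
rewrite /sign_diff !meanB; try by do ?apply: has_momentsB; exact: mL.
rewrite !M ?sqrrN ?expr1n//.
rewrite !(mulN1r, mulrN1, mul1r, mulr1, opprK).
rewrite !(coshR_sinhRN r12) !(coshR_sinhR r12) !(coshR_sinhRN r13) !(coshR_sinhR r13).
rewrite !(coshR_sinhRN r14) !(coshR_sinhR r14) !(coshR_sinhRN r23) !(coshR_sinhR r23).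
rewrite !(coshR_sinhRN r24) !(coshR_sinhR r24) !(coshR_sinhRN r34) !(coshR_sinhR r34).
move: (expR 2) (sinhR r12) (sinhR r13) (sinhR r14) (sinhR r23) (sinhR r24) (sinhR r34)
  (coshR r12) (coshR r13) (coshR r14) (coshR r23) (coshR r24) (coshR r34).
move=> e s12 s13 s14 s23 s24 s34 c12 c13 c14 c23 c24 c34 /=.
by field.
Qed.

Lemma sinhR_norm_le (x : R) : `|x| <= 1 -> `|sinhR x| <= expR 1 * `|x|.
Proof.
move=> x1; have H (y : R) : `|y| <= 1 -> `|expR y - 1| <= expR 1 * `|y|.
  move=> y1; have := expR_taylor 1 y; rewrite big_nat1 expr0 divr1 expr1 mulrC.
  by move/le_trans; apply; rewrite ler_wpM2r// ler_expR.
have := H x x1; have := H (- x); rewrite normrN => /(_ x1).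
by rewrite /sinhR !ler_norml => /andP[? ?] /andP[? ?]; apply/andP; split; lra.
Qed.

Lemma coshR_norm_le (x : R) : `|x| <= 1 -> `|coshR x| <= expR 1.
Proof.
rewrite ler_norml => /andP[a b]; rewrite /coshR.
have : expR x <= expR 1 by rewrite ler_expR.
have : expR (- x) <= expR 1 by rewrite ler_expR; lra.
have := expR_ge0 x; have := expR_ge0 (- x) => ? ? ? ?.
by rewrite ler_norml; apply/andP; split; lra.
Qed.

Lemma prod6_le (k x1 x2 x3 x4 x5 x6 y1 y2 y3 y4 y5 y6 : R) : 0 <= k ->
  `|x1| <= k * y1 -> `|x2| <= k * y2 -> `|x3| <= k * y3 ->
  `|x4| <= k * y4 -> `|x5| <= k * y5 -> `|x6| <= k * y6 ->
  `|x1 * x2 * x3 * x4 * x5 * x6| <= k ^+ 6 * (y1 * y2 * y3 * y4 * y5 * y6).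
Proof.
move=> k0 h1 h2 h3 h4 h5 h6.
have -> : k ^+ 6 * (y1 * y2 * y3 * y4 * y5 * y6) =
  k * y1 * (k * y2) * (k * y3) * (k * y4) * (k * y5) * (k * y6) by ring.
by rewrite !normrM; do ![apply: ler_pM; rewrite ?mulr_ge0//].
Qed.

(** Each of the eight terms of [mean_sinh4] is bounded by the product of two correlations
    which, when summed over the four indices, costs only two free sums: a matching keeps
    both edges, a star keeps two of its three edges, and the whole graph keeps the matching
    of [r12] and [r34], whence the coefficient 2. *)
Lemma mean_sinh4_le a1 a2 a3 a4 (r12 r13 r14 r23 r24 r34 : R) :
  G a1 -> G a2 -> G a3 -> G a4 ->
  mean (fun w => a1 w ^+ 2) = 1 -> mean (fun w => a2 w ^+ 2) = 1 ->
  mean (fun w => a3 w ^+ 2) = 1 -> mean (fun w => a4 w ^+ 2) = 1 ->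
  mean (fun w => a1 w * a2 w) = r12 -> mean (fun w => a1 w * a3 w) = r13 ->
  mean (fun w => a1 w * a4 w) = r14 -> mean (fun w => a2 w * a3 w) = r23 ->
  mean (fun w => a2 w * a4 w) = r24 -> mean (fun w => a3 w * a4 w) = r34 ->
  `|r12| <= 1 -> `|r13| <= 1 -> `|r14| <= 1 ->
  `|r23| <= 1 -> `|r24| <= 1 -> `|r34| <= 1 ->
  mean (fun w => sinhR (a1 w) * sinhR (a2 w) * sinhR (a3 w) * sinhR (a4 w)) <=
  expR 2 * expR 1 ^+ 6 *
   (2 * (`|r12| * `|r34|) + `|r13| * `|r24| + `|r14| * `|r23| +
    `|r12| * `|r13| + `|r12| * `|r23| + `|r13| * `|r34| + `|r14| * `|r34|).
Proof.
move=> G1 G2 G3 G4 v1 v2 v3 v4 e12 e13 e14 e23 e24 e34 b12 b13 b14 b23 b24 b34.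
rewrite (mean_sinh4 G1 G2 G3 G4 v1 v2 v3 v4 e12 e13 e14 e23 e24 e34)/= -[leRHS]mulrA.
rewrite ler_wpM2l ?expR_ge0//; set k := expR 1.
have k0 : 0 <= k by exact: expR_ge0.
have S r : `|r| <= 1 -> `|sinhR r| <= k * `|r| by exact: sinhR_norm_le.
have S1 r : `|r| <= 1 -> `|sinhR r| <= k * 1.
  by move=> r1; apply: le_trans (S r r1) _; rewrite ler_wpM2l.
have C r : `|r| <= 1 -> `|coshR r| <= k * 1 by rewrite mulr1; exact: coshR_norm_le.
apply: (@le_trans _ _ (k ^+ 6 * (`|r12| * `|r34| * 1 * 1 * 1 * 1) +
  k ^+ 6 * (`|r13| * `|r24| * 1 * 1 * 1 * 1) + k ^+ 6 * (`|r14| * `|r23| * 1 * 1 * 1 * 1) +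
  k ^+ 6 * (`|r12| * `|r13| * 1 * 1 * 1 * 1) + k ^+ 6 * (`|r12| * `|r23| * 1 * 1 * 1 * 1) +
  k ^+ 6 * (`|r13| * 1 * `|r34| * 1 * 1 * 1) + k ^+ 6 * (`|r14| * 1 * `|r34| * 1 * 1 * 1) +
  k ^+ 6 * (`|r12| * 1 * 1 * 1 * 1 * `|r34|))); last first.
  by rewrite le_eqVlt; apply/orP; left; apply/eqP; ring.
by do ![apply: lerD]; apply: le_trans (ler_norm _) _; apply: prod6_le => //;
  try exact: S; try exact: S1; exact: C.
Qed.

(** Summable correlations make the fourth moment quadratic in the number of terms. Each of
    the eight products of two correlations in [mean_sinh4_le], summed over the four indices,
    is at most [(N L) ^ 2]. *)
Lemma mean_sinh_sum4_le (N : nat) (a : 'I_N -> Omega -> R) (r : 'I_N -> 'I_N -> R) (L : R) :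
  0 <= L -> (forall i, G (a i)) -> (forall i j, mean (fun w => a i w * a j w) = r i j) ->
  (forall i, r i i = 1) -> (forall i j, `|r i j| <= 1) ->
  (forall i, \sum_j `|r i j| <= L) ->
  mean (fun w => (\sum_i sinhR (a i w)) ^+ 4) <=
  expR 2 * expR 1 ^+ 6 * (8 * (N%:R * L) ^+ 2).
Proof.
move=> L0 Ga er r1 rle rL.
have rsym i j : r i j = r j i.
  by rewrite -!er; congr mean; apply/funext => w; rewrite mulrC.
have rLs j : \sum_i `|r i j| <= L by under eq_bigr do rewrite rsym.
have ms i : has_moments (fun w => sinhR (a i w)) by exact: (gaussian_sinh_moments hG).
have m4 i j k l : has_moments (fun w => sinhR (a i w) * sinhR (a j w) * sinhR (a k w) * sinhR (a l w)).
  by do ![apply: has_momentsM => //].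
have -> : (fun w => (\sum_i sinhR (a i w)) ^+ 4) = fun w =>
    \sum_i \sum_j \sum_k \sum_l
      (sinhR (a i w) * sinhR (a j w) * sinhR (a k w) * sinhR (a l w)).
  apply/funext => w; set s := \sum_i sinhR (a i w).
  transitivity (\sum_i sinhR (a i w) * s * s * s).
    transitivity (s * s * s * s); first by ring.
    by rewrite {1}/s !mulr_suml.
  apply: eq_bigr => i _.
  transitivity (\sum_j sinhR (a i w) * sinhR (a j w) * s * s).
    by rewrite {1}/s mulr_sumr !mulr_suml.
  apply: eq_bigr => j _.
  transitivity (\sum_k sinhR (a i w) * sinhR (a j w) * sinhR (a k w) * s).
    by rewrite {1}/s mulr_sumr mulr_suml.
  by apply: eq_bigr => k _; rewrite mulr_sumr.
have N0 : 0 <= (N%:R : R) by [].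
have sumc (c : R) : \sum_(i < N) c = N%:R * c.
  by rewrite sumr_const card_ord mulr_natl.
pose A i j := `|r i j|.
have A0 i j : 0 <= A i j by exact: normr_ge0.
have A1 i j : A i j <= 1 by exact: rle.
have AL i : \sum_j A i j <= L by exact: rL.
have ALs j : \sum_i A i j <= L by exact: rLs.
have cL (c : R) i : 0 <= c -> \sum_j c * A i j <= c * L.
  by move=> c0; rewrite -mulr_sumr ler_wpM2l.
pose C := expR 2 * expR 1 ^+ 6 : R.
have C0 : 0 <= C by rewrite mulr_ge0 ?exprn_ge0 ?expR_ge0.
pose T i j k l := 2 * (A i j * A k l) + A i k * A j l + A i l * A j k +
  A i j * A i k + A i j * A j k + A i k * A k l + A i l * A k l.
rewrite mean_sum; last by move=> i; do !apply: has_moments_sum => ?.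
apply: (@le_trans _ _ (C * (\sum_i \sum_j \sum_k \sum_l T i j k l))).
  rewrite mulr_sumr; apply: ler_sum => i _.
  rewrite mean_sum; last by move=> j; do !apply: has_moments_sum => ?.
  rewrite mulr_sumr; apply: ler_sum => j _.
  rewrite mean_sum; last by move=> k; do !apply: has_moments_sum => ?.
  rewrite mulr_sumr; apply: ler_sum => k _.
  rewrite mean_sum// mulr_sumr; apply: ler_sum => l _.
  apply: mean_sinh4_le; rewrite ?er//.
rewrite ler_wpM2l//.
have Tl i j k : \sum_l T i j k l <= 2 * A i j * L + A i k * L + A j k * L +
    N%:R * (A i j * A i k) + N%:R * (A i j * A j k) + A i k * L + \sum_l A i l * A k l.
  rewrite !big_split/= !sumc !lerD//.
  - by under eq_bigr do rewrite mulrA; apply: cL; rewrite mulr_ge0.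
  - exact: cL.
  - by rewrite [A j k * L]mulrC -mulr_suml ler_wpM2r.
  - exact: cL.
have Tk i j : \sum_k \sum_l T i j k l <= 4 * (N%:R * L) * A i j + 4 * (L * L).
  apply: le_trans (ler_sum _ (fun k _ => Tl i j k)) _.
  rewrite !big_split/= sumc exchange_big/=.
  have s5 : \sum_j0 \sum_i0 A i j0 * A i0 j0 <= L * L.
    apply: (@le_trans _ _ (\sum_j0 A i j0 * L)); last by rewrite -mulr_suml ler_wpM2r.
    by apply: ler_sum => l _; rewrite -mulr_sumr ler_wpM2l.
  have s1 k0 : \sum_k A k0 k * L <= L * L by rewrite -mulr_suml ler_wpM2r.
  have s2 k0 : \sum_k N%:R * (A i j * A k0 k) <= N%:R * (A i j * L).
    by rewrite -mulr_sumr ler_wpM2l// -mulr_sumr ler_wpM2l.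
  have := s1 i; have := s1 j; have := s2 i; have := s2 j; move: s5.
  move: (\sum_j0 \sum_i0 _) (\sum_(k < N) A i k * L) (\sum_(k < N) A j k * L)
    (\sum_(k < N) N%:R * (A i j * A j k)) (\sum_(k < N) N%:R * (A i j * A i k)).
  by move=> ? ? ? ? ?; lra.
have Tj i : \sum_j \sum_k \sum_l T i j k l <= 8 * (N%:R * (L * L)).
  apply: le_trans (ler_sum _ (fun j _ => Tk i j)) _.
  rewrite big_split/= sumc.
  have := cL (4 * (N%:R * L)) i; rewrite !mulr_ge0// => /(_ isT).
  by move: (\sum_(j < N) _) => ?; lra.
apply: le_trans (ler_sum _ (fun i _ => Tj i)) _.
by rewrite sumc le_eqVlt; apply/orP; left; apply/eqP; ring.
Qed.

End sinh_fourth_moment.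

(** * Gaussian laws and the Gaussian space of the process *)

Section normal_mgf.
Context {R : realType}.
Local Notation mu := (@lebesgue_measure R).
Local Open Scope ereal_scope.

(** [normal_prob] is defined by its values on sets; integrals against it are reduced to
    integrals of the density by identifying the Radon-Nikodym derivative. *)
Lemma ge0_integral_normal_prob (m s : R) (f : R -> \bar R) :
  measurable_fun setT f -> (forall x, 0 <= f x) ->
  \int[normal_prob m s]_x f x = \int[mu]_x (f x * (normal_pdf m s x)%:E).
Proof.
move=> mf f0; have dom := normal_prob_dominates m s.
rewrite -(Radon_Nikodym_SigmaFinite.change_of_variables dom f0 measurableT mf).
have ig := Radon_Nikodym_SigmaFinite.f_integrable dom.
have mg := measurable_int _ ig.
have mp : measurable_fun setT (EFin \o normal_pdf m s).
  by apply/measurable_EFinP; exact: measurable_normal_pdf.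
apply: ae_eq_integral => //; [exact: emeasurable_funM|exact: emeasurable_funM|].
have := integral_ae_eq measurableT ig mp.
have H E : E `<=` [set: R] -> measurable E ->
  \int[mu]_(x in E) Radon_Nikodym_SigmaFinite.f (normal_prob m s) mu x =
  \int[mu]_(x in E) (EFin \o normal_pdf m s) x.
  by move=> _ mE; rewrite -Radon_Nikodym_SigmaFinite.f_integral.
by move=> /(_ H); apply: filterS => x /= h _; rewrite h.
Qed.

(** Completing the square: an exponential factor shifts the mean of the normal density. *)
Lemma normal_pdf_tilt (m s c x : R) : s != 0%R ->
  (expR (c * x) * normal_pdf m s x =
   expR (c * m + c ^+ 2 * s ^+ 2 / 2) * normal_pdf (m + c * s ^+ 2) s x)%R.
Proof.
move=> s0; rewrite !normal_pdfE// mulrCA [RHS]mulrCA; congr (_ * _)%R.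
by rewrite /normal_fun -!expRD; congr expR; field.
Qed.

Lemma normal_mgf (m s c : R) : s != 0%R ->
  \int[normal_prob m s]_x (expR (c * x))%:E = (expR (c * m + c ^+ 2 * s ^+ 2 / 2))%:E.
Proof.
move=> s0; have mexp : measurable_fun setT (fun x : R => (expR (c * x))%:E).
  by apply/measurable_EFinP; apply: measurableT_comp => //; exact: measurable_funM.
rewrite ge0_integral_normal_prob//.
under eq_integral do rewrite -EFinM normal_pdf_tilt// EFinM.
rewrite ge0_integralZl//=.
- by rewrite integral_normal_pdf mule1.
- by apply/measurable_EFinP; exact: measurable_normal_pdf.
- by move=> x _; rewrite lee_fin normal_pdf_ge0.
Qed.

End normal_mgf.

Section gaussian_rv_mgf.
Context d (Omega : measurableType d) (R : realType) (P : probability Omega R).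
Local Notation mean := (mean P).
Local Notation has_moments := (has_moments P).

(** One formula covers the degenerate law, for [s = 0], and the normal laws. *)
Lemma gaussian_rv_mgf (Y : Omega -> R) : measurable_fun setT Y -> gaussian_rv P Y ->
  exists m s : R, forall c : R, (\int[P]_w (expR (c * Y w))%:E =
    (expR (c * m + c ^+ 2 * s ^+ 2 / 2))%:E)%E.
Proof.
move=> mY [m [s [s0 law]]]; exists m, s => c.
have mY' : @measurable_fun _ _ Omega (measurableTypeR R) setT Y by exact: mY.
have mexp : measurable_fun setT (fun x : measurableTypeR R => (expR (c * x))%:E).
  by apply/measurable_EFinP; apply: measurableT_comp => //; exact: measurable_funM.
have e0 : {in setT, forall x : measurableTypeR R, (0 <= (expR (c * x))%:E)%E}.
  by move=> x _; rewrite lee_fin expR_ge0.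
have := ge0_integral_pushforward mY' P measurableT mexp e0.
rewrite preimage_setT => <-.
have [s00|sn0] := eqVneq s 0%R.
  transitivity (\int[\d_(m : measurableTypeR R)]_y (expR (c * y))%:E)%E.
    by apply: eq_measure_integral => A mA _; rewrite [LHS]law// /gaussian_law s00 eqxx.
  by rewrite integral_dirac// diracT mul1e s00 expr0n/= mulr0 mul0r addr0.
rewrite -(normal_mgf m c sn0); apply: eq_measure_integral => A mA _ /=.
by rewrite [LHS]law// /gaussian_law (negbTE sn0).
Qed.

Lemma gaussian_rv_expR_moments (Y : Omega -> R) (u : R) : measurable_fun setT Y ->
  gaussian_rv P Y -> has_moments (fun w => expR (u * Y w)).
Proof.
move=> mY gY; have [m [s H]] := gaussian_rv_mgf mY gY.
have muY v : measurable_fun setT (fun w => expR (v * Y w)).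
  by apply: measurableT_comp => //; exact: measurable_funM.
split=> // n.
have eE : (fun w => (expR (u * Y w) ^+ n)%:E) = (fun w => (expR (n%:R * u * Y w))%:E).
  by apply/funext => w; rewrite -mulrA expRM_natl.
rewrite eE; apply/integrableP; split; first exact/measurable_EFinP.
under eq_integral do rewrite /= ger0_norm ?expR_ge0//.
by rewrite H ltry.
Qed.

Lemma gaussian_rv_has_moments (Y : Omega -> R) : measurable_fun setT Y ->
  gaussian_rv P Y -> has_moments Y.
Proof.
move=> mY gY.
apply: (@has_moments_le _ _ _ _ _ (fun w => expR (1 * Y w) + expR (-1 * Y w))) => //.
  by apply: has_momentsD; exact: gaussian_rv_expR_moments.
by move=> w; rewrite mul1r mulN1r; exact: norm_le_expR.
Qed.

(** The parameters [m] and [s] of the law are not given as moments. The expansion of the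
    Laplace transform identifies [m] with the mean, and then [s ^ 2] with the second moment. *)
Lemma gaussian_rv_centered_mgf (Y : Omega -> R) : measurable_fun setT Y ->
  gaussian_rv P Y -> mean Y = 0 ->
  (\int[P]_w (expR (Y w))%:E = (expR (mean (fun w => Y w ^+ 2) / 2))%:E)%E.
Proof.
move=> mY gY EY; have [m [s H]] := gaussian_rv_mgf mY gY.
have mexp u : has_moments (fun w => expR (u * Y w)) by exact: gaussian_rv_expR_moments.
have mYY : has_moments Y by exact: gaussian_rv_has_moments.
have [K HK] := expR_quadratic_taylor m (s ^+ 2 / 2).
have [] := @mean_cubic_coeffs _ _ _ P Y (cst 1) 1 m (s ^+ 2 / 2 + m ^+ 2 / 2)
   (m * (s ^+ 2 / 2) + m ^+ 3 / 6) K mYY (has_moments_cst P 1) mexp.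
  move=> u u0 u1.
  have -> : mean (fun w => expR (u * Y w) * cst 1 w) = expR (m * u + s ^+ 2 / 2 * u ^+ 2).
    under [X in mean X]eq_fun do rewrite mulr1.
    by rewrite /mean /Rintegral H; congr expR; field.
  exact: HK.
rewrite (_ : (fun w => Y w * cst 1 w) = Y); last by apply/funext => w; rewrite mulr1.
rewrite (_ : (fun w => Y w ^+ 2 * cst 1 w) = fun w => Y w ^+ 2); last first.
  by apply/funext => w; rewrite mulr1.
rewrite EY => _ m0 -> _; have := H 1.
under eq_integral do rewrite mul1r.
by move=> ->; rewrite -m0; congr (expR _)%:E; field.
Qed.

End gaussian_rv_mgf.

Section fbm_gaussian_space.
Context d (Omega : measurableType d) (R : realType) (P : probability Omega R).
Context (X : R -> {RV P >-> R}).
Hypothesis hX : fractional_brownian_motion (6^-1) X.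
Local Notation mean := (mean P).
Local Notation has_moments := (has_moments P).

Definition fbm_span : set (Omega -> R) :=
  [set Y | exists (n : nat) (t c : 'I_n -> R), (forall i, 0 <= t i) /\
     Y = fun w => \sum_(i < n) c i * X (t i) w].

Lemma fbm_span_measurable Y : fbm_span Y -> measurable_fun setT Y.
Proof.
move=> [n [t [c [_ ->]]]]; apply: measurable_sum => i.
exact: measurable_funM.
Qed.

Lemma fbm_span_gaussian Y : fbm_span Y -> gaussian_rv P Y.
Proof. by move=> [n [t [c [t0 ->]]]]; exact: (fbm_gaussian hX). Qed.

Lemma fbm_span_lin Y Z (a b : R) : fbm_span Y -> fbm_span Z ->
  fbm_span (fun w => a * Y w + b * Z w).
Proof.
move=> [n [t [c [t0 ->]]]] [m [t' [c' [t'0 ->]]]].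
exists (n + m)%N, (fun i => match fintype.split i with inl j => t j | inr k => t' k end),
  (fun i => match fintype.split i with inl j => a * c j | inr k => b * c' k end); split.
  by move=> i; case: fintype.split.
apply/funext => w; rewrite big_split_ord/= !mulr_sumr; congr (_ + _).
  by apply: eq_bigr => i _; rewrite (unsplitK (inl i : 'I_n + 'I_m)%type) mulrA.
by apply: eq_bigr => i _; rewrite (unsplitK (inr i : 'I_n + 'I_m)%type) mulrA.
Qed.

Lemma fbm_span_X t : 0 <= t -> fbm_span (X t).
Proof.
move=> t0; exists 1%N, (fun=> t), (fun=> 1); split=> //.
by apply/funext => w; rewrite big_ord1 mul1r.
Qed.

Lemma fbm_span_has_moments Y : fbm_span Y -> has_moments Y.
Proof.
move=> sY; apply: gaussian_rv_has_moments; first exact: fbm_span_measurable.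
exact: fbm_span_gaussian.
Qed.

Lemma fbm_mean t : 0 <= t -> mean (X t) = 0.
Proof.
by move=> t0; have := fbm_centered hX t0; rewrite /mean /Rintegral expectation_def => ->.
Qed.

Lemma fbm_span_mean Y : fbm_span Y -> mean Y = 0.
Proof.
move=> [n [t [c [t0 ->]]]].
have mX i : has_moments (X (t i)) by apply/fbm_span_has_moments/fbm_span_X.
rewrite mean_sum; last by move=> i; exact: has_momentsZ.
by apply: big1 => i _; rewrite meanZ// fbm_mean// mulr0.
Qed.

Lemma fbm_gaussian_space : gaussian_space P fbm_span.
Proof.
split; [exact: fbm_span_measurable|exact: fbm_span_lin|move=> Y sY].
apply: gaussian_rv_centered_mgf; first exact: fbm_span_measurable.
  exact: fbm_span_gaussian.
exact: fbm_span_mean.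
Qed.

Lemma fbm_covE s t : 0 <= s -> 0 <= t ->
  mean (fun w => X s w * X t w) = (cbrt s + cbrt t - cbrt (s - t)) / 2.
Proof.
move=> s0 t0; have := fbm_cov hX t0 s0.
rewrite unlock /mean /Rintegral /= => ->/=.
by rewrite /cbrt (ger0_norm s0) (ger0_norm t0) [LHS]mulrC (addrC (t `^ _)).
Qed.

Definition incr s e : Omega -> R := fun w => X (s + e) w - X s w.

Lemma incr_span s e : 0 <= s -> 0 <= e -> fbm_span (incr s e).
Proof.
move=> s0 e0; have -> : incr s e = fun w => 1 * X (s + e) w + (-1) * X s w.
  by apply/funext => w; rewrite mul1r mulN1r.
by apply: fbm_span_lin; apply: fbm_span_X => //; rewrite addr_ge0.
Qed.

Lemma incr_cov s e t e' : 0 <= s -> 0 <= e -> 0 <= t -> 0 <= e' ->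
  mean (fun w => incr s e w * incr t e' w) =
  (cbrt (s + e - t) + cbrt (s - (t + e')) - cbrt (s - t) - cbrt (s + e - (t + e'))) / 2.
Proof.
move=> s0 e0 t0 e'0.
have mX u : 0 <= u -> has_moments (X u) by move=> ?; apply/fbm_span_has_moments/fbm_span_X.
have se0 : 0 <= s + e by rewrite addr_ge0.
have te0 : 0 <= t + e' by rewrite addr_ge0.
have mXX u v : 0 <= u -> 0 <= v -> has_moments (fun w => X u w * X v w).
  by move=> u0 v0; apply: has_momentsM; exact: mX.
have -> : (fun w => incr s e w * incr t e' w) = fun w =>
   (X (s + e) w * X (t + e') w - X (s + e) w * X t w) -
   (X s w * X (t + e') w - X s w * X t w).
  by apply/funext => w; rewrite /incr; ring.
rewrite !meanB//; try by [exact: mXX|apply: has_momentsB; exact: mXX].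
by rewrite !fbm_covE//; field.
Qed.

End fbm_gaussian_space.

(** * Averages over time of a process *)

Section average_of_process.
Context d (Omega : measurableType d) (R : realType) (P : probability Omega R).
Local Notation mean := (mean P).
Local Notation mu := (@lebesgue_measure R).
Variable T : R.

(** Fubini for the product of [P] and the Lebesgue measure of [0, T]. The process is
    extended by [0] outside [0, T], so that the product is taken with the Lebesgue measure
    of the line; the uniform bound [K] gives integrability over the product by Tonelli. *)
Lemma fubini_mean (f : R -> Omega -> R) (K : R) :
  measurable_fun setT (fun z : Omega * measurableTypeR R => f z.2 z.1) ->
  (forall s, 0 <= s <= T -> P.-integrable setT (EFin \o f s)) ->
  (forall s, 0 <= s <= T -> mean (fun w => `|f s w|) <= K) ->
  (forall w, mu.-integrable `[0, T] (EFin \o f ^~ w)) ->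
  [/\ P.-integrable setT (EFin \o (fun w => \int[mu]_(s in `[0, T]) f s w)),
      mu.-integrable `[0, T] (EFin \o (fun s => mean (f s))) &
      mean (fun w => \int[mu]_(s in `[0, T]) f s w) =
      \int[mu]_(s in `[0, T]) mean (f s)].
Proof.
move=> mf if_ fK iw.
pose D : set (measurableTypeR R) := `[0, T]%classic.
have mD : measurable D by exact: measurable_itv.
pose h (z : Omega * measurableTypeR R) : \bar R := (\1_D z.2 * f z.2 z.1)%:E.
have mh : measurable_fun setT h.
  apply/measurable_EFinP; apply: measurable_funM => //.
  have m1 : measurable_fun setT (\1_D : measurableTypeR R -> R) by exact: measurable_indic.
  have m2 : measurable_fun setT (snd : Omega * measurableTypeR R -> measurableTypeR R).
    exact: measurable_snd.
  exact: (measurableT_comp m1 m2).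
have hD s w : D s -> h (w, s) = (f s w)%:E.
  by move=> Ds; rewrite /h/= indicE mem_set// mul1r.
have hN s w : ~ D s -> h (w, s) = 0%:E.
  by move=> Ds; rewrite /h/= indicE memNset// mul0r.
have DP s : D s -> 0 <= s <= T by rewrite /D/= in_itv.
have fine_mean s : 0 <= s <= T -> (\int[P]_w (f s w)%:E = (mean (f s))%:E)%E.
  by move=> /if_ ifs; rewrite /mean /Rintegral fineK//; exact: integrable_fin_num.
have fine_norm s : 0 <= s <= T -> (\int[P]_w `|(f s w)%:E| = (mean (fun w => `|f s w|))%:E)%E.
  move=> /if_ ifs; rewrite /mean /Rintegral fineK//.
  by apply: integrable_fin_num => //; exact: integrable_norm.
have ih : (P \x mu)%E.-integrable setT h.
  apply/(integrable21ltyP P mu mh).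
  apply: (@le_lt_trans _ _ (\int[mu]_(s in D) K%:E)%E).
    rewrite [leRHS]integral_mkcond; apply: ge0_le_integral => //.
    - by move=> s _; exact: integral_ge0.
    - apply: (measurable_fun_fubini_tonelli_G (abse \o h)) => //=.
      exact: measurableT_comp.
    - apply/(measurable_restrictT _ mD); exact: measurable_cst.
    - move=> s _; rewrite patchE; case: ifPn => [/set_mem Ds|/negP Ds].
        under eq_integral do rewrite hD//.
        by rewrite fine_norm ?DP// lee_fin fK// DP.
      have nDs : ~ D s by move=> /mem_set.
      by rewrite integral0_eq// => w _; rewrite hN// abse0.
  rewrite integral_cst//= lebesgue_measure_itv/=; case: ifPn => _; last by rewrite mule0 ltry.
  by rewrite -EFinB -EFinM ltry.
have Fw w : fubini_F mu h w = (\int[mu]_(s in `[0, T]) f s w)%:E.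
  rewrite /fubini_F /Rintegral fineK; last by apply: integrable_fin_num; [exact: mD|exact: iw].
  rewrite [RHS]integral_mkcond; apply: eq_integral => s _; rewrite patchE.
  case: ifPn => [/set_mem Ds|/negP Ds]; first by rewrite hD.
  by rewrite hN// => /mem_set.
have Gs s : (\int[P]_w h (w, s) = ((fun s => (mean (f s))%:E) \_ D) s)%E.
  rewrite patchE; case: ifPn => [/set_mem Ds|/negP Ds].
    by under eq_integral do rewrite hD//; rewrite fine_mean ?DP.
  have nDs : ~ D s by move=> /mem_set.
  by rewrite integral0_eq// => w _; rewrite hN.
have iF : P.-integrable setT (EFin \o (fun w => \int[mu]_(s in `[0, T]) f s w)).
  by have := integrable_fubini_F ih; apply: eq_integrable => // w _; exact: Fw.
have iG : mu.-integrable `[0, T] (EFin \o (fun s => mean (f s))).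
  have mG : measurable_fun D (fun s => (mean (f s))%:E).
    apply/(measurable_restrictT _ mD).
    have := measurable_fubini_G ih; apply: eq_measurable_fun => s _.
    by rewrite /fubini_G Gs.
  apply: measurable_bounded_integrable => //.
  - by rewrite /= lebesgue_measure_itv/=; case: ifPn => // _; rewrite -EFinB ltry.
  - exact/measurable_EFinP.
  - exists K; split; first by rewrite num_real.
    move=> M KM s /DP sT; apply: le_trans (ltW KM); apply: le_trans (fK s sT).
    by apply: le_normr_Rintegral => //; exact: if_.
split=> //.
have E1 : (\int[P]_w (\int[mu]_(s in `[0, T]) f s w)%:E =
    \int[P]_w \int[mu]_s h (w, s))%E.
  by apply: eq_integral => w _; rewrite -Fw.
have E2 : (\int[mu]_(s in D) (mean (f s))%:E = \int[mu]_s \int[P]_w h (w, s))%E.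
  by rewrite [LHS]integral_mkcond; apply: eq_integral => s _; rewrite Gs.
by congr fine; rewrite E1 E2; exact: Fubini ih.
Qed.
End average_of_process.

(** * Joint measurability of the process *)

Section fbm_paths.
Context d (Omega : measurableType d) (R : realType) (P : probability Omega R).
Context (X : R -> {RV P >-> R}).
Hypothesis hX : fractional_brownian_motion (6^-1) X.

Lemma continuous_max0 : continuous (fun s : R => Num.max 0 s).
Proof.
move=> s; apply: (@continuous_max R R (cst 0) id s); first exact: cvg_cst.
exact: cvg_id.
Qed.

Lemma fbm_path_continuous w : continuous (fun s : R => X (Num.max 0 s) w).
Proof.
move=> s; have /subspace_continuousP cX := fbm_continuous hX (w := w).
have m0 (u : R) : `[0, +oo[%classic (Num.max 0 u).
  by rewrite /= in_itv/= andbT le_max lexx.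
apply: cvg_trans (cX _ (m0 s)) => A /= wA.
change (nbhs s [set u | A (X (Num.max 0 u) w)]).
have cm : nbhs s [set u | `[0, +oo[%classic (Num.max 0 u) -> A (X (Num.max 0 u) w)].
  exact: (continuous_max0 wA).
by apply: filterS cm => u /=; apply; exact: m0.
Qed.

(** By continuity of the paths, the process is the pointwise limit of its discretizations
    in time, each of which is measurable on countably many measurable rectangles. Times are
    clamped to the half-line on which the paths are known to be continuous. *)
Lemma fbm_joint_measurable :
  measurable_fun setT (fun z : Omega * measurableTypeR R => X (Num.max 0 z.2) z.1).
Proof.
pose t (N : nat) (s : R) : R := (Num.truncn (N.+1%:R * Num.max 0 s))%:R / N.+1%:R.
have tcvg s : t N s @[N --> \oo] --> Num.max 0 s.
  apply/cvgrPdist_lt => e e0; near=> N.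
  have m0 : 0 <= N.+1%:R * Num.max 0 s by rewrite mulr_ge0// le_max lexx.
  have /andP[t1 t2] := truncn_itv m0.
  have N0 : 0 < N.+1%:R :> R by [].
  have ub : Num.max 0 s - t N s < e.
    apply: (@lt_trans _ _ N.+1%:R^-1); last by near: N; exact: (near_infty_natSinv_lt (PosNum e0)).
    have e1 : N.+1%:R * t N s = (Num.truncn (N.+1%:R * Num.max 0 s))%:R.
      by rewrite /t mulrC divfK ?gt_eqF.
    rewrite -(ltr_pM2l N0) mulrBr e1 divff ?gt_eqF//.
    by move: t2; rewrite -natr1; lra.
  have lb : 0 <= Num.max 0 s - t N s by rewrite subr_ge0 ler_pdivrMr// [leRHS]mulrC.
  by rewrite ger0_norm.
have mt N k : measurable [set s : measurableTypeR R | Num.truncn (N.+1%:R * Num.max 0 s) = k].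
  have c : continuous (fun s : R => N.+1%:R * Num.max 0 s).
    by move=> s; apply: cvgM; [exact: cvg_cst|exact: continuous_max0].
  have := continuous_measurable_fun c measurableT (measurable_itv `[k%:R, k.+1%:R[).
  rewrite setTI; congr measurable; apply/seteqP; split => s /=; rewrite in_itv/=.
    by move=> h; apply/eqP; rewrite truncn_eq// mulr_ge0// le_max lexx.
  by move=> /eqP; rewrite truncn_eq// mulr_ge0// le_max lexx.
apply: (@measurable_fun_cvg _ _ _ _ (fun N z => X (t N z.2) z.1)).
  move=> N _ B mB; rewrite setTI.
  have -> : (fun z : Omega * measurableTypeR R => X (t N z.2) z.1) @^-1` B =
      \bigcup_k ((X (k%:R / N.+1%:R) @^-1` B) `*`
         [set s : measurableTypeR R | Num.truncn (N.+1%:R * Num.max 0 s) = k]).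
    apply/seteqP; split => -[w s] /=.
      by move=> Bz; exists (Num.truncn (N.+1%:R * Num.max 0 s)).
    by move=> [k _ [/= Bw ek]]; rewrite /t ek.
  apply: bigcupT_measurable => k; apply: measurableX; last exact: mt.
  have mX : measurable_fun setT (X (k%:R / N.+1%:R)) by [].
  have := mX measurableT B mB.
  by rewrite setTI.
move=> [w s] _ /=.
have t0 N : 0 <= t N s by rewrite divr_ge0.
have -> : (fun N => X (t N s) w) = (fun N => X (Num.max 0 (t N s)) w).
  by apply/funext => N; rewrite (max_idPr _).
have mm : Num.max 0 (Num.max 0 s) = Num.max 0 s by apply/max_idPr; rewrite le_max lexx.
have := continuous_cvg _ (@fbm_path_continuous w (Num.max 0 s)) (tcvg s).
by rewrite mm; apply.
Unshelve. all: by end_near.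
Qed.

End fbm_paths.

(** * Integrals over bounded intervals *)

Section interval_integrals.
Context {R : realType}.
Local Notation mu := (@lebesgue_measure R).
Implicit Types (g : R -> R) (a b e s t T : R).

Lemma continuous_pow g n : continuous g -> continuous (fun t => g t ^+ n).
Proof.
move=> cg t; apply: (@continuous_comp _ _ _ g (fun x : R => x ^+ n) t (cg t)).
exact: exprn_continuous.
Qed.

Lemma integrable_itv_continuous g a b : continuous g ->
  mu.-integrable `[a, b] (EFin \o g).
Proof.
move=> cg; apply: continuous_compact_integrable; first exact: segment_compact.
exact: continuous_subspaceT.
Qed.

Lemma Rintegral_itv_cst a b (c : R) : a <= b -> \int[mu]_(t in `[a, b]) c = c * (b - a).
Proof.
move=> ab; rewrite Rintegral_cst//= lebesgue_measure_itv/= lte_fin.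
by case: ltP => //= ba; rewrite (@le_anti _ _ a b) ?ab// subrr.
Qed.

Lemma Rintegral_itv_le g a b (c : R) : a <= b -> mu.-integrable `[a, b] (EFin \o g) ->
  (forall t, a <= t <= b -> g t <= c) -> \int[mu]_(t in `[a, b]) g t <= c * (b - a).
Proof.
move=> ab ig gc; rewrite -Rintegral_itv_cst//; apply: le_Rintegral => //.
by apply: integrable_itv_continuous => x; exact: cvg_cst.
Qed.

Lemma Rintegral_itv_ge g a b (c : R) : a <= b -> mu.-integrable `[a, b] (EFin \o g) ->
  (forall t, a <= t <= b -> c <= g t) -> c * (b - a) <= \int[mu]_(t in `[a, b]) g t.
Proof.
move=> ab ig gc; rewrite -Rintegral_itv_cst//; apply: le_Rintegral => //.
by apply: integrable_itv_continuous => x; exact: cvg_cst.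
Qed.

Lemma Rintegral_itv_split g a b c : continuous g -> a <= b -> b <= c ->
  \int[mu]_(t in `[a, c]) g t = \int[mu]_(t in `[a, b]) g t + \int[mu]_(t in `[b, c]) g t.
Proof.
move=> cg ab bc; have ic := integrable_itv_continuous a c cg.
have := Rintegral_itvB ic (x := b); rewrite !bnd_simp => /(_ ab bc) => e.
rewrite -(@Rintegral_itv_obnd_cbnd _ b); first by rewrite -e addrC subrK.
apply: integrableS (integrable_itv_continuous b c cg) => //.
by apply: subset_itvr; rewrite bnd_simp.
Qed.

Lemma Rintegral_itv_shift g a b e : continuous g -> a <= b ->
  \int[mu]_(t in `[a, b]) g (t + e) = \int[mu]_(t in `[a + e, b + e]) g t.
Proof.
move=> cg ab; have dF : (fun t : R => t + e)^`()%classic = cst 1.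
  by apply/funext => t; rewrite derive1E deriveD// derive_id derive_cst addr0.
congr fine; rewrite (@integration_by_substitution_increasing _ (fun t => t + e) g a b)//.
- by apply: eq_integral => t _; rewrite dF /= mulr1.
- by move=> x y _ _ xy; rewrite ltrD2r.
- by rewrite dF => x _; exact: cvg_cst.
- by rewrite dF; exact: is_cvg_cst.
- by rewrite dF; exact: is_cvg_cst.
- have cD : continuous (fun t : R => t + e).
    by move=> x; apply: cvgD; [exact: cvg_id|exact: cvg_cst].
  split=> //.
  + exact/cvg_at_right_filter/cD.
  + exact/cvg_at_left_filter/cD.
- exact: continuous_subspaceT.
Qed.

Lemma continuous_incr_corr_norm s e :
  continuous (fun t => `|incr_corr ((s - t) / e)|).
Proof.
have ch : continuous (half_incr : R -> R).
  move=> y; apply: cvgM; last exact: cvg_cst.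
  apply: cvgB; last exact: continuous_cbrt.
  have cD : {for y, continuous (fun z : R => z + 1)}.
    by apply: cvgD; [exact: cvg_id|exact: cvg_cst].
  by apply: (continuous_comp cD); exact: continuous_cbrt.
move=> t.
have cst_ : {for t, continuous (fun t : R => (s - t) / e)}.
  by apply: cvgM; [apply: cvgB; [exact: cvg_cst|exact: cvg_id]|exact: cvg_cst].
apply: cvg_norm; apply: (continuous_comp cst_).
apply: cvgB; first exact: ch.
have cD : {for (s - t) / e, continuous (fun z : R => z - 1)}.
  by apply: cvgB; [exact: cvg_id|exact: cvg_cst].
by apply: (continuous_comp cD); exact: ch.
Qed.

(** The continuous analogue of [sum_incr_corr_norm]. The integrand is dominated by
    [g t - g (t + e)] with [|g| <= 7], whose integral telescopes to two integrals of [g] over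
    intervals of length [e]. *)
Lemma integral_incr_corr_le T e s : 0 <= T -> 0 < e ->
  \int[mu]_(t in `[0, T]) `|incr_corr ((s - t) / e)| <= 14 * e.
Proof.
move=> T0 e0; pose g t := corr_var ((s - t) / e).
have cst_ t : {for t, continuous (fun t : R => (s - t) / e)}.
  by apply: cvgM; [apply: cvgB; [exact: cvg_cst|exact: cvg_id]|exact: cvg_cst].
have cg : continuous g.
  by move=> t; apply: (continuous_comp (cst_ t)); exact: continuous_corr_var.
have cge : continuous (fun t => g (t + e)).
  have cD : continuous (fun t : R => t + e).
    by move=> x; apply: cvgD; [exact: cvg_id|exact: cvg_cst].
  by move=> t; apply: (continuous_comp (cD t)); exact: cg.
have crho := @continuous_incr_corr_norm s e.
apply: (@le_trans _ _ (\int[mu]_(t in `[0, T]) (g t - g (t + e)))).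
  apply: le_Rintegral => //; first exact: integrable_itv_continuous.
    apply: (@integrable_itv_continuous (fun t => g t - g (t + e))) => t.
    by apply: cvgB; [exact: cg|exact: cge].
  move=> t _; apply: le_trans (incr_corr_le_var _) _.
  rewrite /g (_ : (s - (t + e)) / e = (s - t) / e - 1)//.
  by rewrite opprD addrA mulrDl mulNr divff// gt_eqF.
rewrite RintegralB//; [|exact: integrable_itv_continuous..].
rewrite Rintegral_itv_shift// add0r.
have := Rintegral_itv_split cg (ltW e0) (_ : e <= T + e); rewrite lerDr => /(_ T0) e1.
have := Rintegral_itv_split cg T0 (_ : T <= T + e); rewrite lerDl => /(_ (ltW e0)) e2.
have g7 t : - 7 <= g t <= 7 by rewrite -ler_norml; exact: corr_var_bound.
have : \int[mu]_(t in `[0, e]) g t <= 7 * (e - 0).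
  apply: Rintegral_itv_le => //; first exact: ltW.
    exact: integrable_itv_continuous.
  by move=> t _; case/andP: (g7 t).
have : - 7 * (T + e - T) <= \int[mu]_(t in `[T, T + e]) g t.
  apply: Rintegral_itv_ge => //; first by rewrite lerDl ltW.
    exact: integrable_itv_continuous.
  by move=> t _; case/andP: (g7 t).
lra.
Qed.

Lemma Rintegral_itv_cauchy_schwarz g T : 0 < T -> continuous g ->
  (\int[mu]_(t in `[0, T]) g t) ^+ 2 <= T * \int[mu]_(t in `[0, T]) g t ^+ 2.
Proof.
move=> T0 cg; set I := \int[mu]_(t in _) g t; set J := \int[mu]_(t in _) _.
pose c := I / T.
have cg2 : continuous (fun t => g t ^+ 2).
  exact: continuous_pow.
have ccg : continuous (fun t => 2 * c * g t).
  by move=> t; apply: cvgM; [exact: cvg_cst|exact: cg].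
have cc2 : continuous (fun _ : R => c ^+ 2) by move=> t; exact: cvg_cst.
(* Integrate the square of [g] minus its average. *)
have : 0 <= \int[mu]_(t in `[0, T]) (g t ^+ 2 - 2 * c * g t + c ^+ 2).
  by apply: Rintegral_ge0 => t _; have := sqr_ge0 (g t - c); rewrite sqrrB; lra.
rewrite RintegralD//; last exact: integrable_itv_continuous.
  rewrite RintegralB//; [|exact: integrable_itv_continuous..].
  rewrite RintegralZl//; last exact: integrable_itv_continuous.
  rewrite (Rintegral_itv_cst _ (ltW T0)) -/I -/J subr0.
  rewrite -(ler_pM2l T0) mulr0 mulrDr mulrBr.
  have -> : T * (2 * c * I) = 2 * I ^+ 2 by rewrite /c; field; rewrite gt_eqF.
  have -> : T * (c ^+ 2 * T) = I ^+ 2 by rewrite /c; field; rewrite gt_eqF.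
  by lra.
apply: (@integrable_itv_continuous (fun t => g t ^+ 2 - 2 * c * g t)) => t.
by apply: cvgB; [exact: cg2|exact: ccg].
Qed.

End interval_integrals.

(** * First and second moments of the cubic variation *)

Section cubic_variation_moments.
Context d (Omega : measurableType d) (R : realType) (P : probability Omega R).
Context (X : R -> {RV P >-> R}).
Hypothesis hX : fractional_brownian_motion (6^-1) X.
Variables (T : R) (T0 : 0 < T).
Local Notation mean := (mean P).
Local Notation has_moments := (has_moments P).
Local Notation mu := (@lebesgue_measure R).
Local Notation incr := (incr X).
Local Notation rho := incr_corr.
Implicit Types (s t e : R) (B : Omega -> R) (w : Omega).

(** Equal to the increment at nonnegative times, but continuous in [s] and jointly
    measurable on the whole line. *)
Definition clamped_incr e s w := X (Num.max 0 (s + e)) w - X (Num.max 0 s) w.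

Lemma clamped_incrE e s w : 0 <= e -> 0 <= s -> clamped_incr e s w = incr s e w.
Proof. by move=> e0 s0; rewrite /clamped_incr !(max_idPr _)// addr_ge0. Qed.

Lemma clamped_incr_continuous e w : continuous (fun s => clamped_incr e s w).
Proof.
move=> s; have cD : continuous (fun t : R => t + e).
  by move=> x; apply: cvgD; [exact: cvg_id|exact: cvg_cst].
apply: cvgB; last exact: fbm_path_continuous.
exact: (@continuous_comp _ _ _ (fun t => t + e) (fun t => X (Num.max 0 t) w) s (cD s)
  (@fbm_path_continuous _ _ _ _ _ hX w (s + e))).
Qed.

Lemma clamped_incr_measurable e :
  measurable_fun setT (fun z : Omega * measurableTypeR R => clamped_incr e z.2 z.1).
Proof.
have mX := fbm_joint_measurable hX.
apply: measurable_funB => //.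
have mt : measurable_fun setT
    (fun z : Omega * measurableTypeR R => (z.1, z.2 + e) : Omega * measurableTypeR R).
  apply: measurable_fun_pair; first exact: measurable_fst.
  have m2 : measurable_fun setT (fun s : measurableTypeR R => s + e : measurableTypeR R).
    have cD : continuous (fun t : R => t + e).
      by move=> x; apply: cvgD; [exact: cvg_id|exact: cvg_cst].
    exact: (continuous_measurable_fun cD).
  have m1 : measurable_fun setT (snd : Omega * measurableTypeR R -> measurableTypeR R).
    exact: measurable_snd.
  exact: (measurableT_comp m2 m1).
exact: (measurableT_comp mX mt).
Qed.

Lemma cubic_variationE e w : 0 <= e ->
  cubic_variation X T e w = e^-1 * \int[mu]_(s in `[0, T]) clamped_incr e s w ^+ 3.
Proof.
move=> e0; congr (_ * _); apply: eq_Rintegral => s; rewrite inE/= in_itv/= => /andP[s0 _].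
by rewrite clamped_incrE.
Qed.

Lemma incr_moments e s : 0 <= e -> 0 <= s -> has_moments (incr s e).
Proof. by move=> e0 s0; apply/(fbm_span_has_moments hX)/incr_span. Qed.

Lemma incr_var e s : 0 <= e -> 0 <= s -> mean (fun w => incr s e w ^+ 2) = cbrt e.
Proof.
move=> e0 s0; have -> : (fun w => incr s e w ^+ 2) = fun w => incr s e w * incr s e w.
  by apply/funext => w; rewrite expr2.
rewrite (incr_cov hX)// subrr cbrt0 subr0 (_ : s + e - s = e); last by ring.
rewrite (_ : s - (s + e) = - e); last by ring.
by rewrite subrr cbrt0 cbrtN; field.
Qed.

Lemma incr_cov_corr e s t : 0 < e -> 0 <= s -> 0 <= t ->
  mean (fun w => incr s e w * incr t e w) = cbrt e * rho ((s - t) / e).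
Proof.
move=> e0 s0 t0; have ge0 := ltW e0.
rewrite (incr_cov hX)// incr_corrE mulrBr mulrA mulrDr -!cbrtM.
have en0 : e != 0 by rewrite gt_eqF.
have -> : e * ((s - t) / e + 1) = s + e - t by field.
have -> : e * ((s - t) / e - 1) = s - (t + e) by field.
have -> : e * ((s - t) / e) = s - t by field.
have -> : s + e - (t + e) = s - t by ring.
by field.
Qed.

Lemma mean_incr_cube_cube e s t : 0 < e -> 0 <= s -> 0 <= t ->
  mean (fun w => incr s e w ^+ 3 * incr t e w ^+ 3) =
  e * (9 * rho ((s - t) / e) + 6 * rho ((s - t) / e) ^+ 3).
Proof.
move=> e0 s0 t0; have hG := fbm_gaussian_space hX.
have ge0 := ltW e0.
rewrite (mean_cube_cube hG); [|exact: incr_span..].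
rewrite incr_cov_corr// !incr_var//.
have ce : e = cbrt e ^+ 3 by rewrite cbrt_exp3 gtr0_norm.
move: (rho _) => r; transitivity (cbrt e ^+ 3 * (9 * r + 6 * r ^+ 3)); first by ring.
by rewrite -ce.
Qed.

Lemma mean_incr_pow6 e s : 0 < e -> 0 <= s ->
  mean (fun w => incr s e w ^+ 6) = 15 * e.
Proof.
move=> e0 s0; have := mean_incr_cube_cube e0 s0 s0.
rewrite subrr mul0r incr_corr0 => h.
have -> : (fun w => incr s e w ^+ 6) = fun w => incr s e w ^+ 3 * incr s e w ^+ 3.
  by apply/funext => w; rewrite -exprD.
by rewrite h; ring.
Qed.

(** Fubini; the integrand [A_s ^ 3 B] is dominated by [A_s ^ 6 + B ^ 2], whose mean does not
    depend on [s]. *)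
Lemma mean_cubic_variation_mul e B : 0 < e -> measurable_fun setT B ->
  P.-integrable setT (EFin \o (fun w => B w ^+ 2)) ->
  [/\ P.-integrable setT (EFin \o (fun w => cubic_variation X T e w * B w)),
      mu.-integrable `[0, T] (EFin \o (fun s => mean (fun w => incr s e w ^+ 3 * B w))) &
      mean (fun w => cubic_variation X T e w * B w) =
      e^-1 * \int[mu]_(s in `[0, T]) mean (fun w => incr s e w ^+ 3 * B w)].
Proof.
move=> e0 mB iB; have ge0 := ltW e0.
pose f s w := clamped_incr e s w ^+ 3 * B w.
have mA : measurable_fun setT (fun z : Omega * measurableTypeR R => clamped_incr e z.2 z.1).
  exact: clamped_incr_measurable.
have fE s : 0 <= s -> f s = fun w => incr s e w ^+ 3 * B w.
  by move=> s0; apply/funext => w; rewrite /f clamped_incrE.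
have mf : measurable_fun setT (fun z : Omega * measurableTypeR R => f z.2 z.1).
  apply: measurable_funM; first exact: measurable_funX.
  have m1 : measurable_fun setT (fst : Omega * measurableTypeR R -> Omega).
    exact: measurable_fst.
  exact: (measurableT_comp mB m1).
have mI s : 0 <= s -> has_moments (incr s e) by move=> s0; exact: incr_moments.
have idom s : 0 <= s -> P.-integrable setT (EFin \o (fun w => incr s e w ^+ 6 + B w ^+ 2)).
  move=> s0; have := integrableD measurableT (has_moments_integrable (has_momentsX 6 (mI s s0))) iB.
  by apply: eq_integrable.
have ledom s w : 0 <= s -> `|f s w| <= incr s e w ^+ 6 + B w ^+ 2.
  move=> s0; rewrite fE// normrM -[6%N]/(3 * 2)%N exprM.
  rewrite -[(incr s e w ^+ 3) ^+ 2]real_normK ?num_real// -[B w ^+ 2]real_normK ?num_real//.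
  have := normr_ge0 (incr s e w ^+ 3); have := normr_ge0 (B w).
  set y := `|_|; set x := `|_|; have := sqr_ge0 (x - y); nra.
have mfs s : 0 <= s -> measurable_fun setT (f s).
  move=> s0; rewrite fE//; apply: measurable_funM => //; apply: measurable_funX.
  by have [] := mI s s0.
have ifs s : 0 <= s -> P.-integrable setT (EFin \o f s).
  by move=> s0; apply: (integrable_le (mfs s s0) (idom s s0)) => w; exact: ledom.
have ifw w : mu.-integrable `[0, T] (EFin \o f ^~ w).
  apply: integrable_itv_continuous => s; apply: cvgM; last exact: cvg_cst.
  exact: (@continuous_pow _ (fun s => clamped_incr e s w) 3 (@clamped_incr_continuous e w) s).
have [] := @fubini_mean _ _ _ P T f (15 * e + mean (fun w => B w ^+ 2)) mf.
- by move=> s /andP[s0 _]; exact: ifs.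
- move=> s /andP[s0 _]; rewrite -(mean_incr_pow6 e0 s0) /mean -RintegralD//; last first.
    exact: has_moments_integrable (has_momentsX 6 (mI s s0)).
  apply: le_Rintegral => //; last by move=> w _; exact: ledom.
    exact: integrable_norm (ifs s s0).
  exact: idom.
- exact: ifw.
have VB w : cubic_variation X T e w * B w = e^-1 * \int[mu]_(s in `[0, T]) f s w.
  rewrite cubic_variationE// -mulrA -RintegralZr//.
  apply: (@integrable_itv_continuous _ (fun s => clamped_incr e s w ^+ 3)).
  by apply: continuous_pow; exact: clamped_incr_continuous.
move=> iF iG eF; split.
- have := integrableZl measurableT e^-1 iF; apply: eq_integrable => // w _.
  by rewrite /= VB EFinM.
- apply: eq_integrable iG => // s; rewrite inE/= in_itv/= => /andP[s0 _].
  by rewrite /= fE.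
- have -> : (fun w => cubic_variation X T e w * B w) =
      fun w => e^-1 * \int[mu]_(s in `[0, T]) f s w by apply/funext => w; exact: VB.
  rewrite /mean RintegralZl// -/(mean _) eF; congr (_ * _).
  by apply: eq_Rintegral => s; rewrite inE/= in_itv/= => /andP[s0 _]; rewrite fE.
Qed.

Lemma cubic_variation_measurable e : 0 < e -> measurable_fun setT (cubic_variation X T e).
Proof.
move=> e0; have [] := @mean_cubic_variation_mul e (cst 1) e0 (measurable_cst _).
  exact: has_moments_integrable (has_momentsX 2 (has_moments_cst P 1)).
move=> /(measurable_int P)/measurable_EFinP + _ _; congr (measurable_fun _ _).
by apply/funext => w; rewrite mulr1.
Qed.

(** By the Cauchy-Schwarz inequality in time, the square is at most a multiple of the time
    integral of the sixth powers of the increments. *)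
Lemma cubic_variation_sqr_integrable e : 0 < e ->
  P.-integrable setT (EFin \o (fun w => cubic_variation X T e w ^+ 2)).
Proof.
move=> e0; have ge0 := ltW e0; have mA := clamped_incr_measurable e.
pose f s w := clamped_incr e s w ^+ 6.
have mI s : 0 <= s -> has_moments (f s).
  move=> s0; apply: has_momentsX; have := incr_moments ge0 s0.
  by congr has_moments; apply/funext => w; rewrite clamped_incrE.
have f0 s w : 0 <= f s w by exact: exprn_even_ge0.
have [] := @fubini_mean _ _ _ P T f (15 * e).
- exact: measurable_funX.
- by move=> s /andP[s0 _]; apply/has_moments_integrable/mI.
- move=> s /andP[s0 _]; rewrite le_eqVlt -(mean_incr_pow6 e0 s0); apply/orP; left.
  apply/eqP; congr mean; apply/funext => w.
  by rewrite ger0_norm// /f clamped_incrE.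
- move=> w; apply: (@integrable_itv_continuous _ (fun s => clamped_incr e s w ^+ 6)).
  by apply: continuous_pow; exact: clamped_incr_continuous.
move=> iF _ _; have := integrableZl measurableT (e^-1 ^+ 2 * T) iF => iF'.
apply: (@integrable_le _ _ _ _ _
    (fun w => e^-1 ^+ 2 * T * \int[mu]_(s in `[0, T]) f s w)).
- by apply: measurable_funX; exact: cubic_variation_measurable.
- by apply: eq_integrable iF'.
move=> w; rewrite ger0_norm ?sqr_ge0// cubic_variationE// exprMn -mulrA.
rewrite ler_wpM2l ?sqr_ge0//.
have := @Rintegral_itv_cauchy_schwarz _ (fun s => clamped_incr e s w ^+ 3) T T0
  (@continuous_pow _ _ 3 (@clamped_incr_continuous e w)).
move=> /le_trans; apply; rewrite le_eqVlt; apply/orP; left; apply/eqP; congr (_ * _).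
by apply: eq_Rintegral => s _; rewrite /f -exprM.
Qed.

(** Applying [mean_cubic_variation_mul] twice gives the double integral of [E[A_s ^ 3 A_t ^ 3]],
    which is [e] times [9 rho + 6 rho ^ 3 <= 15 |rho|] at [(s - t) / e]. The integral of
    [|rho|] in [t] is at most [14 e], and [210 = 15 * 14]. *)
Lemma mean_cubic_variation_sqr_le e : 0 < e ->
  mean (fun w => cubic_variation X T e w ^+ 2) <= 210 * T.
Proof.
move=> e0; have ge0 := ltW e0; set V := cubic_variation X T e.
have mV : measurable_fun setT V by exact: cubic_variation_measurable.
have iV := cubic_variation_sqr_integrable e0.
have [_ i1 e1] := mean_cubic_variation_mul e0 mV iV.
have -> : (fun w => V w ^+ 2) = fun w => V w * V w by apply/funext => w; rewrite expr2.
rewrite e1; apply: (@le_trans _ _ (e^-1 * (210 * e * (T - 0)))); last first.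
  by rewrite le_eqVlt; apply/orP; left; apply/eqP; field; rewrite gt_eqF.
rewrite ler_wpM2l ?invr_ge0//; apply: Rintegral_itv_le => //; first exact: ltW.
move=> s /andP[s0 sT].
have mA3 : has_moments (fun w => incr s e w ^+ 3) by apply/has_momentsX/incr_moments.
have [_ i2 e2] := mean_cubic_variation_mul e0 (has_moments_measurable mA3)
  (has_moments_integrable (has_momentsX 2 mA3)).
have -> : mean (fun w => incr s e w ^+ 3 * V w) = mean (fun w => V w * incr s e w ^+ 3).
  by congr mean; apply/funext => w; rewrite mulrC.
rewrite e2; apply: (@le_trans _ _ (e^-1 * (15 * e * (14 * e)))); last first.
  by rewrite le_eqVlt; apply/orP; left; apply/eqP; field; rewrite gt_eqF.
rewrite ler_wpM2l ?invr_ge0//.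
have ir : mu.-integrable `[0, T] (EFin \o (fun t => `|rho ((s - t) / e)|)).
  exact: (integrable_itv_continuous _ _ (@continuous_incr_corr_norm _ s e)).
apply: (@le_trans _ _ (\int[mu]_(t in `[0, T]) (15 * e * `|rho ((s - t) / e)|))).
  apply: le_Rintegral => //.
    apply: (@integrable_itv_continuous _ (fun t => 15 * e * `|rho ((s - t) / e)|)) => t.
    by apply: cvgM; [exact: cvg_cst|exact: continuous_incr_corr_norm].
  move=> t; rewrite /= in_itv/= => /andP[t0 tT].
  rewrite mean_incr_cube_cube// -mulrA [15 * _]mulrCA ler_wpM2l//.
  rewrite -incr_corrN -mulNr opprB; set r := rho _.
  have r1 : `|r| <= 1 by exact: incr_corr_norm.
  have r3 : r ^+ 3 <= `|r|.
    rewrite (le_trans (ler_norm _))// normrX exprS ler_piMr// exprn_ile1//.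
  by have := ler_norm r; lra.
rewrite RintegralZl// ler_wpM2l ?mulr_ge0//.
by apply: integral_incr_corr_le => //; exact: ltW.
Qed.

End cubic_variation_moments.

(** * The test variable *)

Section test_variable.
Context d (Omega : measurableType d) (R : realType) (P : probability Omega R).
Context (X : R -> {RV P >-> R}).
Hypothesis hX : fractional_brownian_motion (6^-1) X.
Variables (T : R) (T0 : 0 < T).
Local Notation mean := (mean P).
Local Notation has_moments := (has_moments P).
Local Notation mu := (@lebesgue_measure R).
Local Notation incr := (incr X).
Local Notation rho := incr_corr.
Implicit Types (s t e : R) (B : Omega -> R) (w : Omega) (N k : nat).

Definition incr_sd e : R := Num.sqrt (cbrt e).

Definition unit_incr e k w : R := (incr_sd e)^-1 * incr (k%:R * e) e w.

(** A discretized substitute for the cubic variation with steps of length [e]. Hyperbolic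
    sines replace cubes because the means of products of four of them have a closed form,
    while the correlation with the cube of a Gaussian variable is still a positive
    combination of the covariance and of its cube ([mean_cube_sinh]). *)
Definition sinh_sum e N w : R := incr_sd e ^+ 3 * \sum_(k < N) sinhR (unit_incr e k w).

Lemma incr_sd_gt0 e : 0 < e -> 0 < incr_sd e.
Proof. by move=> e0; rewrite sqrtr_gt0 cbrt_gt0// gt_eqF. Qed.

Lemma incr_sd_sqr e : incr_sd e ^+ 2 = cbrt e.
Proof. by rewrite sqr_sqrtr// cbrt_ge0. Qed.

Lemma incr_sd_pow6 e : 0 < e -> incr_sd e ^+ 6 = e.
Proof.
by move=> e0; rewrite -[6%N]/(2 * 3)%N exprM incr_sd_sqr cbrt_exp3 gtr0_norm.
Qed.

Lemma unit_incr_span e k : 0 < e -> fbm_span X (unit_incr e k).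
Proof.
move=> e0; apply: (gaussian_scale (fbm_gaussian_space hX)); apply: incr_span.
  by rewrite mulr_ge0// ltW.
exact: ltW.
Qed.

Lemma mean_unit_incr_mul e i j : 0 < e ->
  mean (fun w => unit_incr e i w * unit_incr e j w) = rho (i%:R - j%:R).
Proof.
move=> e0; have k0 := incr_sd_gt0 e0; have ge0 := ltW e0.
have -> : (fun w => unit_incr e i w * unit_incr e j w) = fun w =>
    (incr_sd e)^-1 ^+ 2 * (incr (i%:R * e) e w * incr (j%:R * e) e w).
  by apply/funext => w; rewrite /unit_incr; ring.
rewrite meanZ; last by apply: has_momentsM; apply: (incr_moments hX) => //; rewrite mulr_ge0.
rewrite (incr_cov_corr hX) ?mulr_ge0// -incr_sd_sqr mulrA -exprMn mulVf ?gt_eqF//.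
by rewrite expr1n mul1r -mulrBl mulfK// gt_eqF.
Qed.

Lemma mean_unit_incr_sqr e k : 0 < e -> mean (fun w => unit_incr e k w ^+ 2) = 1.
Proof.
move=> e0; have := mean_unit_incr_mul k k e0; rewrite subrr incr_corr0 => <-.
by congr mean; apply/funext => w; rewrite expr2.
Qed.

Lemma sinh_unit_incr_moments e k : 0 < e -> has_moments (fun w => sinhR (unit_incr e k w)).
Proof.
by move=> e0; apply: (gaussian_sinh_moments (fbm_gaussian_space hX)); exact: unit_incr_span.
Qed.

Lemma sinh_sum_moments e N : 0 < e -> has_moments (sinh_sum e N).
Proof.
move=> e0; apply: has_momentsZ; apply: has_moments_sum => k.
exact: sinh_unit_incr_moments.
Qed.

Lemma mean_sinh_sum_pow4_le e N : 0 < e ->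
  mean (fun w => sinh_sum e N w ^+ 4) <=
  expR 2 * expR 1 ^+ 6 * 8 * (14 * (N%:R * e)) ^+ 2.
Proof.
move=> e0; have k0 := incr_sd_gt0 e0.
have ms : has_moments (fun w => \sum_(k < N) sinhR (unit_incr e k w)).
  by apply: has_moments_sum => k; exact: sinh_unit_incr_moments.
have -> : (fun w => sinh_sum e N w ^+ 4) = fun w =>
    e ^+ 2 * (\sum_(k < N) sinhR (unit_incr e k w)) ^+ 4.
  apply/funext => w; rewrite /sinh_sum exprMn -exprM -[(3 * 4)%N]/(6 * 2)%N exprM.
  by rewrite incr_sd_pow6.
rewrite meanZ; last exact: has_momentsX.
have := @mean_sinh_sum4_le _ _ _ P _ (fbm_gaussian_space hX) N
  (fun k : 'I_N => unit_incr e k) (fun i j : 'I_N => rho (i%:R - j%:R)) 14 (ler0n _ _)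
  (fun i => unit_incr_span i e0) (fun i j => mean_unit_incr_mul i j e0).
have r0 (i : 'I_N) : rho (i%:R - i%:R : R) = 1 by rewrite subrr incr_corr0.
move=> /(_ r0 (fun i j => incr_corr_norm _) (fun i => sum_incr_corr_norm _ _)) H.
apply: le_trans (ler_wpM2l (sqr_ge0 e) H) _.
by rewrite le_eqVlt; apply/orP; left; apply/eqP; ring.
Qed.

Lemma mean_incr_cube_sinh_sum e N (A : Omega -> R) : 0 < e -> fbm_span X A ->
  mean (fun w => A w ^+ 3 * sinh_sum e N w) =
  incr_sd e ^+ 3 * expR 2^-1 * \sum_(k < N)
   (3 * mean (fun w => A w ^+ 2) * mean (fun w => A w * unit_incr e k w) +
    mean (fun w => A w * unit_incr e k w) ^+ 3).
Proof.
move=> e0 sA; have hG := fbm_gaussian_space hX.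
have mA := gaussian_has_moments hG sA.
have -> : (fun w => A w ^+ 3 * sinh_sum e N w) = fun w =>
    incr_sd e ^+ 3 * \sum_(k < N) A w ^+ 3 * sinhR (unit_incr e k w).
  by apply/funext => w; rewrite /sinh_sum mulrCA -mulr_sumr.
have mk k : has_moments (fun w => A w ^+ 3 * sinhR (unit_incr e k w)).
  by apply: has_momentsM; [exact: has_momentsX|exact: sinh_unit_incr_moments].
rewrite meanZ; last by apply: has_moments_sum => k.
rewrite mean_sum// -mulrA; congr (_ * _); rewrite mulr_sumr.
apply: eq_bigr => k _; rewrite (mean_cube_sinh hG)//; last exact: unit_incr_span.
by rewrite mean_unit_incr_sqr// mul1r.
Qed.

Definition cube_lb : R := 24^-1 * 24^-1 * (12^-1 * 12^-1 * 12^-1).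

(** At each time [s], the correlation of [A_s ^ 3] with the sum is, up to positive factors,
    [3 rho + rho ^ 3] summed over the grid seen from [s / e]; the first sum is nonnegative and
    the second one is at least [cube_lb]. The powers of [incr_sd e] combine to [e], which
    cancels the normalization of the cubic variation. The grid extends two steps beyond [T]
    as required by [sum_incr_corr_cube_ge]. *)
Lemma mean_cubic_variation_sinh_sum_ge e N : 0 < e -> T + 2 * e <= N%:R * e ->
  T * cube_lb <= mean (fun w => cubic_variation X T e w * sinh_sum e N w).
Proof.
move=> e0 TN; have k0 := incr_sd_gt0 e0; have ge0 := ltW e0.
have mZ := sinh_sum_moments N e0.
have [_ iG ->] := mean_cubic_variation_mul hX T e0 (has_moments_measurable mZ)
  (has_moments_integrable (has_momentsX 2 mZ)).
rewrite ler_pdivlMl//.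
have -> : e * (T * cube_lb) = e * cube_lb * (T - 0) by rewrite subr0; ring.
apply: Rintegral_itv_ge => //; first exact: ltW.
move=> s /andP[s0 sT].
rewrite mean_incr_cube_sinh_sum//; last exact: incr_span.
have cE k : mean (fun w => incr s e w * unit_incr e k w) = incr_sd e * rho (s / e - k%:R).
  have -> : (fun w => incr s e w * unit_incr e k w) = fun w =>
      (incr_sd e)^-1 * (incr s e w * incr (k%:R * e) e w).
    by apply/funext => w; rewrite /unit_incr mulrCA.
  rewrite meanZ; last by apply: has_momentsM; apply: (incr_moments hX) => //; rewrite mulr_ge0.
  rewrite (incr_cov_corr hX) ?mulr_ge0// -incr_sd_sqr.
  have -> : (s - k%:R * e) / e = s / e - k%:R by field; rewrite gt_eqF.
  by field; rewrite gt_eqF.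
under eq_bigr do rewrite cE (incr_var hX)// -incr_sd_sqr.
have -> : \sum_(k < N) (3 * incr_sd e ^+ 2 * (incr_sd e * rho (s / e - k%:R)) +
    (incr_sd e * rho (s / e - k%:R)) ^+ 3) =
    incr_sd e ^+ 3 * (3 * \sum_(k < N) rho (s / e - k%:R) +
                      \sum_(k < N) rho (s / e - k%:R) ^+ 3).
  rewrite mulr_sumr -big_split/= mulr_sumr; apply: eq_bigr => k _; ring.
have se0 : 0 <= s / e by rewrite divr_ge0.
have seN : s / e + 2 <= N%:R.
  by rewrite -(ler_pM2r e0) mulrDl divfK ?gt_eqF//; lra.
have S1 := sum_incr_corr_ge0 se0 seN.
have S3 := sum_incr_corr_cube_ge se0 seN.
have ek x : incr_sd e ^+ 3 * expR 2^-1 * (incr_sd e ^+ 3 * x) = e * (expR 2^-1 * x).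
  transitivity (incr_sd e ^+ 6 * (expR 2^-1 * x)); first by ring.
  by rewrite incr_sd_pow6.
rewrite ek ler_wpM2l//.
have h1 : 1 <= expR (2^-1 : R) by rewrite -[leLHS]expR0 ler_expR.
rewrite -[leLHS]mul1r; apply: ler_pM => //; first by rewrite !mulr_ge0.
by apply: le_trans S3 _; lra.
Qed.

(** An increment over the fixed length [e'] is asymptotically uncorrelated with the increments
    over a fine grid: its covariances with them are differences of [cbrt] along the grid, whose
    sum is bounded by [sum_cbrt_grid] although the number of steps grows. The normalization
    of [sinh_sum] then leaves a factor [incr_sd e ^+ 2 = cbrt e]. *)
Lemma mean_cubic_variation_sinh_sum_small e e' N : 0 < e -> 0 < e' -> e' <= T ->
  N%:R * e <= 3 * T ->
  `|mean (fun w => cubic_variation X T e' w * sinh_sum e N w)| <=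
  e'^-1 * T * (8 * expR 2^-1 * cbrt e' * cbrt (4 * T)) * cbrt e.
Proof.
move=> e0 e'0 e'T NT; have k0 := incr_sd_gt0 e0; have ge0 := ltW e0; have ge'0 := ltW e'0.
have mZ := sinh_sum_moments N e0.
have [_ iG ->] := mean_cubic_variation_mul hX T e'0 (has_moments_measurable mZ)
  (has_moments_integrable (has_momentsX 2 mZ)).
rewrite normrM ger0_norm ?invr_ge0// -!mulrA ler_wpM2l ?invr_ge0//.
apply: le_trans (le_normr_Rintegral _ iG) _; first exact: measurable_itv.
set M := 8 * _.
have -> : T * M = M * (T - 0) by rewrite subr0 mulrC.
apply: Rintegral_itv_le; [exact: ltW|exact: integrable_norm iG|].
move=> s /andP[s0 sT].
have sA := incr_span X s0 ge'0; have mA := incr_moments hX ge'0 s0.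
rewrite mean_incr_cube_sinh_sum// (incr_var hX)//.
pose r k := mean (fun w => incr s e' w * unit_incr e k w).
(* Cauchy-Schwarz against a variable of unit variance. *)
have r2 k : r k ^+ 2 <= cbrt e'.
  have ma := gaussian_has_moments (fbm_gaussian_space hX) (unit_incr_span k e0).
  have : 0 <= mean (fun w => (1 * incr s e' w + (- r k) * unit_incr e k w) ^+ 2).
    by apply: mean_ge0 => w; exact: sqr_ge0.
  rewrite mean_sqr_lin// (incr_var hX)// mean_unit_incr_sqr// -/(r k).
  by set c := cbrt e'; set x := r k; lra.
have rle k : `|3 * cbrt e' * r k + r k ^+ 3| <= 4 * cbrt e' * `|r k|.
  have -> : 3 * cbrt e' * r k + r k ^+ 3 = (3 * cbrt e' + r k ^+ 2) * r k by ring.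
  rewrite normrM ler_wpM2r// ger0_norm; first by have := r2 k; lra.
  by have := cbrt_ge0 e'; have := sqr_ge0 (r k); lra.
have rE k : `|r k| <= (incr_sd e)^-1 * (2^-1 *
    (`|cbrt (s + e' - k%:R * e) - cbrt (s + e' - k.+1%:R * e)| +
     `|cbrt (s - k%:R * e) - cbrt (s - k.+1%:R * e)|)).
  have -> : r k = (incr_sd e)^-1 * mean (fun w => incr s e' w * incr (k%:R * e) e w).
    rewrite -meanZ; last by apply: has_momentsM => //; apply: (incr_moments hX) => //; rewrite mulr_ge0.
    by congr mean; apply/funext => w; rewrite /unit_incr mulrCA.
  rewrite normrM gtr0_norm ?invr_gt0// ler_wpM2l ?invr_ge0 ?(ltW k0)//.
  rewrite (incr_cov hX) ?mulr_ge0//.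
  have -> : k%:R * e + e = k.+1%:R * e by rewrite -natr1; ring.
  have -> : (cbrt (s + e' - k%:R * e) + cbrt (s - k.+1%:R * e) - cbrt (s - k%:R * e) -
      cbrt (s + e' - k.+1%:R * e)) / 2 = 2^-1 *
     ((cbrt (s + e' - k%:R * e) - cbrt (s + e' - k.+1%:R * e)) -
     (cbrt (s - k%:R * e) - cbrt (s - k.+1%:R * e))) by ring.
  by rewrite normrM ger0_norm// ler_wpM2l// ler_normB.
have c4 x : - (4 * T) <= x -> x <= 4 * T -> cbrt x <= cbrt (4 * T).
  move=> x1 x2; apply: le_cbrt; rewrite [leRHS]ger0_norm ?mulr_ge0 ?(ltW T0)//.
  by rewrite ler_norml x1.
have Ne0 : 0 <= N%:R * e by rewrite mulr_ge0.
have Sr : \sum_(k < N) `|r k| <= (incr_sd e)^-1 * (2 * cbrt (4 * T)).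
  apply: le_trans (ler_sum _ (fun (k : 'I_N) _ => rE k)) _.
  rewrite -mulr_sumr ler_wpM2l ?invr_ge0 ?(ltW k0)// -mulr_sumr big_split/=.
  have := sum_cbrt_grid (s + e') N ge0; have := sum_cbrt_grid s N ge0.
  have := c4 s; have := c4 (s + e'); have := c4 (s - N%:R * e); have := c4 (s + e' - N%:R * e).
  move: (\sum_(k < N) _) (\sum_(k < N) _) => S1 S2.
  move: (cbrt s) (cbrt (s + e')) (cbrt (s - N%:R * e)) (cbrt (s + e' - N%:R * e)) (cbrt (4 * T)).
  move=> a b c f g /(_ ltac:(lra) ltac:(lra)) h1 /(_ ltac:(lra) ltac:(lra)) h2.
  move=> /(_ ltac:(lra) ltac:(lra)) h3 /(_ ltac:(lra) ltac:(lra)) h4 h5 h6; lra.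
rewrite normrM ger0_norm; last by rewrite mulr_ge0 ?exprn_ge0 ?expR_ge0 ?(ltW k0).
apply: (@le_trans _ _ (incr_sd e ^+ 3 * expR 2^-1 *
    (4 * cbrt e' * ((incr_sd e)^-1 * (2 * cbrt (4 * T)))))).
  rewrite ler_wpM2l ?mulr_ge0 ?exprn_ge0 ?expR_ge0 ?(ltW k0)//.
  apply: le_trans (ler_norm_sum _ _ _) _.
  apply: le_trans (ler_sum _ (fun (k : 'I_N) _ => rle k)) _.
  by rewrite -mulr_sumr ler_wpM2l// mulr_ge0 ?cbrt_ge0.
rewrite /M -(incr_sd_sqr e) le_eqVlt; apply/orP; left; apply/eqP.
by field; rewrite gt_eqF.
Qed.

End test_variable.

(** * Tail estimates *)

Section probability_tools.
Context d (Omega : measurableType d) (R : realType) (P : probability Omega R).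

Lemma exists_ratio_lt (T r : R) : 0 < T -> 0 < r -> exists n : nat, T / n.+1%:R < r.
Proof.
move=> T0 r0; exists (Num.truncn (T / r)).
by rewrite ltr_pdivrMr// mulrC -ltr_pdivrMr// truncnS_gt.
Qed.

(** If [q] is small then [q z] is controlled by the first term. Otherwise Young's inequality
    splits [q z] into squares, and again [z ^ 2] into a small multiple of [z ^ 4] and a large
    constant, which is only paid on the event [b] where [q] is large. After taking means, all
    the terms are small when [z] has a bounded fourth moment, [q] a bounded second moment,
    and [b] a small probability. *)
Lemma mul_le_tail (delta eta kap q z : R) (b : bool) :
  0 < delta -> 0 < eta -> 0 < kap -> (delta <= `|q| -> b) ->
  q * z <= delta * (2 + z ^+ 4) + eta * q ^+ 2 +
           (4 * eta)^-1 * (kap * z ^+ 4 + (4 * kap)^-1 * b%:R).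
Proof.
move=> d0 e0 k0 qb.
have z4 : z ^+ 4 = (z ^+ 2) ^+ 2 by rewrite -exprM.
have Z2 := sqr_ge0 z; have Q2 := sqr_ge0 q.
have Z4 : 0 <= z ^+ 4 by rewrite z4 sqr_ge0.
have c0 : 0 < (4 * eta)^-1 by rewrite invr_gt0 mulr_gt0.
have c1 : 0 < (4 * kap)^-1 by rewrite invr_gt0 mulr_gt0.
have [qd|qd] := ltP `|q| delta.
  have h1 : q * z <= delta * (2 + z ^+ 4).
    apply: le_trans (ler_norm _) _; rewrite normrM.
    apply: ler_pM => //; first exact: ltW.
    have := sqr_ge0 (`|z| - 2^-1); have := sqr_ge0 (z ^+ 2 - 2^-1).
    have -> : z ^+ 4 = `|z| ^+ 2 ^+ 2 by rewrite real_normK ?num_real// z4.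
    have -> : z ^+ 2 = `|z| ^+ 2 by rewrite real_normK ?num_real.
    by move: `|z| => x; lra.
  have h2 : 0 <= eta * q ^+ 2 by rewrite mulr_ge0// ltW.
  have h3 : 0 <= (4 * eta)^-1 * (kap * z ^+ 4 + (4 * kap)^-1 * b%:R).
    by apply: mulr_ge0; [exact: ltW|apply: addr_ge0; apply: mulr_ge0 => //; exact: ltW].
  by lra.
rewrite (qb qd) mulr1.
have h1 : q * z <= eta * q ^+ 2 + (4 * eta)^-1 * z ^+ 2.
  rewrite -subr_ge0.
  have -> : eta * q ^+ 2 + (4 * eta)^-1 * z ^+ 2 - q * z =
      eta * (q - (2 * eta)^-1 * z) ^+ 2 by field; rewrite gt_eqF.
  by rewrite mulr_ge0 ?sqr_ge0// ltW.
have h2 : z ^+ 2 <= kap * z ^+ 4 + (4 * kap)^-1.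
  rewrite -subr_ge0.
  have -> : kap * z ^+ 4 + (4 * kap)^-1 - z ^+ 2 = kap * (z ^+ 2 - (2 * kap)^-1) ^+ 2.
    by field; rewrite gt_eqF.
  by rewrite mulr_ge0 ?sqr_ge0// ltW.
have h3 := ler_wpM2l (ltW c0) h2.
have h4 : 0 <= delta * (2 + z ^+ 4) by rewrite mulr_ge0 ?(ltW d0)// addr_ge0.
by lra.
Qed.

Lemma measurable_norm_ge (U : Omega -> R) (delta : R) : measurable_fun setT U ->
  measurable [set w | delta <= `|U w|].
Proof.
move=> mU; have mnU : measurable_fun setT (fun w => `|U w|) by exact: measurableT_comp.
have := mnU measurableT _ (measurable_itv `[delta, +oo[); rewrite setTI.
by congr measurable; apply/seteqP; split => w /=; rewrite in_itv/= andbT.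
Qed.

Lemma poweR_2 (x : \bar R) : (0 <= x)%E -> (x `^ 2 = x * x)%E.
Proof.
case: x => [x|_|//]; last by rewrite mulyy poweRyr//; apply/eqP; lra.
by rewrite lee_fin => x0; rewrite poweR_EFin (powR_mulrn 2 x0) expr2 EFinM.
Qed.

(** Markov's inequality for the square. *)
Lemma prob_ge_le_Lnorm2 (U : Omega -> R) (delta : R) : 0 < delta -> measurable_fun setT U ->
  (P [set w | (delta <= `|U w|)%R] <=
   (delta ^- 2)%:E * (Lnorm P 2%:E (fun w => (U w)%:E) * Lnorm P 2%:E (fun w => (U w)%:E)))%E.
Proof.
move=> d0 mU.
have mB := measurable_norm_ge delta mU.
rewrite -poweR_2 ?Lnorm_ge0// powR_Lnorm; last by apply/eqP; lra.
have d2 : 0 < delta ^+ 2 by exact: exprn_gt0.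
set B := [set w | _] in mB *.
apply: (@le_trans _ _ ((delta ^- 2)%:E * ((delta ^+ 2)%:E * P B))%E).
  by rewrite muleA -EFinM mulVf ?mul1e// lt0r_neq0.
rewrite lee_wpmul2l// ?lee_fin ?invr_ge0 ?(ltW d2)//.
rewrite -[X in (_ * P X)%E]setIT -integral_indic// -ge0_integralZl//.
- apply: ge0_le_integral => //.
  + by move=> w _; rewrite -EFinM lee_fin mulr_ge0// exprn_ge0// ltW.
  + by apply/measurable_EFinP; apply: measurable_funM => //; exact: measurable_indic.
  + under eq_fun do rewrite poweR_EFin.
    apply/measurable_EFinP; apply: (measurableT_comp (measurable_powR 2)).
    exact: measurableT_comp.
  + move=> w _; rewrite poweR_EFin -EFinM lee_fin powR_mulrn// indicE.
    have [|_] := boolP (w \in B); last by rewrite mulr0 exprn_ge0.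
    by rewrite inE/= mulr1 => dU; apply: lerXn2r; rewrite ?nnegrE// ltW.
- exact/measurable_EFinP/measurable_indic.
- by rewrite lee_fin exprn_ge0// ltW.
Qed.

End probability_tools.

(** * Convergence in mean square and in probability *)

Section convergence_modes.
Context d (Omega : measurableType d) (R : realType) (P : probability Omega R).
Context (V : R -> Omega -> R).
Hypothesis mV : forall e : R, 0 < e -> measurable_fun setT (V e).

(** If both [V e] and [V e'] are within [delta / 2] of [Y], they are within [delta] of each
    other. *)
Lemma cvg_in_probability_cauchy (Y : {RV P >-> R}) : cvg_in_probability V 0^'+ Y ->
  forall delta r : R, 0 < delta -> 0 < r -> exists2 e0 : R, 0 < e0 &
      forall e e', 0 < e -> e < e0 -> 0 < e' -> e' < e0 ->
        fine (P [set w | delta <= `|V e w - V e' w|]) <= r.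
Proof.
move=> cV delta r d0 r0.
have d2 : 0 < delta / 2 by rewrite divr_gt0.
have r2 : (0 < (r / 2)%:E)%E by rewrite lte_fin divr_gt0.
have near0 : nbhs (0 : \bar R) [set x | (x < (r / 2)%:E)%E].
  by apply: open_nbhs_nbhs; split => //; exact: open_ereal_lt_ereal.
have := cV _ d2 _ near0; rewrite /nbhs/= => -[e0 /= e00 He0]; exists e0 => // e e' e1 e2 e'1 e'2.
have small (a : R) : 0 < a -> a < e0 -> (P [set w | (delta / 2 <= `|V a w - Y w|)%R] < (r / 2)%:E)%E.
  by move=> a0 ae; apply: He0 => //=; rewrite sub0r normrN gtr0_norm.
have mS (a : R) : 0 < a -> measurable [set w | delta / 2 <= `|V a w - Y w|].
  by move=> a0; apply: measurable_norm_ge; apply: measurable_funB => //; exact: mV.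
rewrite -lee_fin fineK ?fin_num_measure//; last first.
  by apply: measurable_norm_ge; apply: measurable_funB; exact: mV.
apply: (@le_trans _ _ (P ([set w | delta / 2 <= `|V e w - Y w|] `|`
    [set w | delta / 2 <= `|V e' w - Y w|]))).
  apply: le_measure; rewrite ?inE.
  - by apply: measurable_norm_ge; apply: measurable_funB; exact: mV.
  - by apply: measurableU; exact: mS.
  move=> w /= dw; have [|h] := leP (delta / 2) `|V e w - Y w|; first by left.
  right; have := ler_distD (Y w) (V e w) (V e' w); rewrite [`|Y w - _|]distrC; lra.
apply: (le_trans (measureU2 P (mS _ e1) (mS _ e'1))).
have -> : r = r / 2 + r / 2 by lra.
by rewrite EFinD; apply: leeD; apply: ltW; exact: small.
Qed.

Lemma cvg_in_L2_probability (Y : Omega -> R) : cvg_in_L2 P V 0^'+ Y ->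
  exists Y' : {RV P >-> R}, cvg_in_probability V 0^'+ Y'.
Proof.
move=> [LY cV].
have mY : Y \in mfun by exact: sub_Lfun_mfun LY.
exists (mfun_Sub mY) => delta d0 /=.
have YE : (mfun_Sub mY : Omega -> R) = Y by [].
have mY' : measurable_fun setT Y by rewrite -YE.
apply: (@squeeze_cvge _ _ _ _ (cst 0%E) _ (fun eps => ((delta ^- 2)%:E *
  (Lnorm P 2%:E (fun w => (V eps w - Y w)%:E) * Lnorm P 2%:E (fun w => (V eps w - Y w)%:E)))%E)).
- near=> e; rewrite measure_ge0/=.
  by apply: prob_ge_le_Lnorm2 => //; apply: measurable_funB => //; apply: mV; near: e; exact: nbhs_right_gt.
- exact: cvg_cst.
- rewrite -[X in _ --> X](mule0 (delta ^- 2)%:E); apply: cvgeZl => //.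
  by rewrite -[X in _ --> X](mule0 0%E); apply: cvgeM.
Unshelve. all: by end_near. Qed.

End convergence_modes.

(** * The cubic variations are not Cauchy in probability *)

Section no_limit.
Context d (Omega : measurableType d) (R : realType) (P : probability Omega R).
Context (X : R -> {RV P >-> R}).
Hypothesis hX : fractional_brownian_motion (6^-1) X.
Variables (T : R) (T0 : 0 < T).
Local Notation mean := (mean P).
Local Notation V := (cubic_variation X T).

(** The mean of [mul_le_tail] for [q = V e - V e'] and the event where it is at least [delta]. *)
Lemma mean_cubic_variation_diff_le e e' delta eta kap (Z : Omega -> R) :
  0 < e -> 0 < e' -> 0 < delta -> 0 < eta -> 0 < kap -> has_moments P Z ->
  mean (fun w => V e w * Z w) - mean (fun w => V e' w * Z w) <=
  delta * (2 + mean (fun w => Z w ^+ 4)) + eta * (4 * (210 * T)) +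
  (4 * eta)^-1 * (kap * mean (fun w => Z w ^+ 4) +
    (4 * kap)^-1 * fine (P [set w | delta <= `|V e w - V e' w|])).
Proof.
move=> e0 e'0 d0 et0 k0 mZ; set B := [set w | _].
have mV := cubic_variation_measurable hX T e0.
have mV' := cubic_variation_measurable hX T e'0.
have mB : measurable B.
  by apply: measurable_norm_ge; exact: measurable_funB.
have mZ4 := has_momentsX 4 mZ.
have iZ := has_moments_integrable (has_momentsX 2 mZ).
have [iVZ _ _] := mean_cubic_variation_mul hX T e0 (has_moments_measurable mZ) iZ.
have [iV'Z _ _] := mean_cubic_variation_mul hX T e'0 (has_moments_measurable mZ) iZ.
have iV := cubic_variation_sqr_integrable hX T0 e0.
have iV' := cubic_variation_sqr_integrable hX T0 e'0.
pose F1 w := delta * (2 + Z w ^+ 4) + (4 * eta)^-1 * kap * Z w ^+ 4.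
have mF1 : has_moments P F1.
  apply: has_momentsD; last exact: has_momentsZ.
  by apply: has_momentsZ; apply: has_momentsD => //; exact: has_moments_cst.
have EF1 : mean F1 = delta * (2 + mean (fun w => Z w ^+ 4)) +
    (4 * eta)^-1 * kap * mean (fun w => Z w ^+ 4).
  have m2 : has_moments P (fun w => 2 + Z w ^+ 4).
    by apply: has_momentsD => //; exact: has_moments_cst.
  rewrite meanD; [|exact: has_momentsZ..].
  rewrite !meanZ// meanD//; last exact: has_moments_cst.
  by rewrite (mean_cst P 2).
pose F2 w := 2 * eta * V e w ^+ 2.
pose F3 w := 2 * eta * V e' w ^+ 2.
pose F4 w := (4 * eta)^-1 * (4 * kap)^-1 * \1_B w : R.
have iF2 : P.-integrable setT (EFin \o F2).
  by have := integrableZl measurableT (2 * eta) iV; apply: eq_integrable.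
have iF3 : P.-integrable setT (EFin \o F3).
  by have := integrableZl measurableT (2 * eta) iV'; apply: eq_integrable.
have i1B : P.-integrable setT (EFin \o (\1_B : Omega -> R)).
  exact: integrable_indic.
have iF4 : P.-integrable setT (EFin \o F4).
  have := integrableZl measurableT ((4 * eta)^-1 * (4 * kap)^-1) i1B.
  by apply: eq_integrable.
have iF1 := has_moments_integrable mF1.
have i12 : P.-integrable setT (EFin \o (fun w => F1 w + F2 w)).
  by have := integrableD measurableT iF1 iF2; apply: eq_integrable.
have i123 : P.-integrable setT (EFin \o (fun w => F1 w + F2 w + F3 w)).
  by have := integrableD measurableT i12 iF3; apply: eq_integrable.
have i1234 : P.-integrable setT (EFin \o (fun w => F1 w + F2 w + F3 w + F4 w)).
  by have := integrableD measurableT i123 iF4; apply: eq_integrable.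
have iL : P.-integrable setT (EFin \o (fun w => V e w * Z w - V e' w * Z w)).
  by have := integrableB measurableT iVZ iV'Z; apply: eq_integrable.
have le w : V e w * Z w - V e' w * Z w <= F1 w + F2 w + F3 w + F4 w.
  rewrite -mulrBl; have := @mul_le_tail R delta eta kap (V e w - V e' w) (Z w) (w \in B) d0 et0 k0.
  move=> /(_ _)/le_trans; apply; first by move=> dB; rewrite inE.
  rewrite /F1 /F2 /F3 /F4 indicE.
  have : eta * (V e w - V e' w) ^+ 2 <= 2 * eta * V e w ^+ 2 + 2 * eta * V e' w ^+ 2.
    rewrite -mulrDr -[2 * eta]mulrC -mulrA ler_wpM2l ?(ltW et0)//.
    have := sqr_ge0 (V e w + V e' w); rewrite sqrrD sqrrB; lra.
  by rewrite [_ * (_ + (4 * kap)^-1 * _)]mulrDr !mulrA; lra.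
have := le_mean iL i1234 le.
rewrite {1}/mean RintegralB// -/(mean _) -/(mean _) => /le_trans; apply.
rewrite /mean RintegralD// RintegralD// RintegralD// -/(mean F1) EF1.
have E2 : \int[P]_w F2 w <= 2 * eta * (210 * T).
  rewrite /F2 RintegralZl// ler_wpM2l ?mulr_ge0 ?(ltW et0)//.
  exact: mean_cubic_variation_sqr_le.
have E3 : \int[P]_w F3 w <= 2 * eta * (210 * T).
  rewrite /F3 RintegralZl// ler_wpM2l ?mulr_ge0 ?(ltW et0)//.
  exact: mean_cubic_variation_sqr_le.
have -> : \int[P]_w F4 w = (4 * eta)^-1 * (4 * kap)^-1 * fine (P B).
  rewrite /F4 RintegralZl//; congr (_ * _).
  by rewrite /Rintegral integral_indic// setIT.
rewrite [(4 * eta)^-1 * (_ + _)]mulrDr ![(4 * eta)^-1 * (_ * _)]mulrA.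
move: E2 E3; rewrite /mean; set F2m := \int[P]_w F2 w; set F3m := \int[P]_w F3 w.
set z := \int[P]_w _; set p := fine _; clearbody F2m F3m z p.
by move: (210 * T) (4 * eta)^-1 (4 * kap)^-1 => C2 u v; lra.
Qed.

(** Fix [e'] and let [e] tend to [0]. For [Z = sinh_sum X e N], the mean of [(V e - V e') Z]
    stays above a positive constant, since the mean of [V e Z] is at least [c] and that of
    [V e' Z] tends to [0]. But it is small by [mean_cubic_variation_diff_le] if [V e - V e'] is
    small in probability. *)
Lemma not_cauchy_in_probability :
  ~ (forall delta r : R, 0 < delta -> 0 < r -> exists2 e0 : R, 0 < e0 &
      forall e e', 0 < e -> e < e0 -> 0 < e' -> e' < e0 ->
        fine (P [set w | delta <= `|V e w - V e' w|]) <= r).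
Proof.
move=> H.
pose C4 : R := expR 2 * expR 1 ^+ 6 * 8 * (14 * (3 * T)) ^+ 2.
have C40 : 0 < C4.
  by rewrite !mulr_gt0 ?exprn_gt0 ?mulr_gt0 ?expR_gt0.
have C4E : C4 = expR 2 * expR 1 ^+ 6 * 8 * (14 * (3 * T)) ^+ 2 by [].
clearbody C4.
pose c : R := T * cube_lb R.
have c0 : 0 < c by rewrite /c /cube_lb; apply: mulr_gt0 => //; lra.
have cE : T * cube_lb R = c by [].
clearbody c.
pose C2 := 210 * T.
have C20 : 0 < C2 by rewrite mulr_gt0 ?ltr0n.
have C2E : 210 * T = C2 by [].
clearbody C2.
(* The parameters are chosen in this order so that each of the four error terms of
   [mean_cubic_variation_diff_le] is at most [c / 8]. With the mean of [V e' Z] at most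
   [c / 4], this leaves [c <= 3 c / 4]. *)
pose eta := c / (8 * (4 * C2)).
have et0 : 0 < eta by rewrite divr_gt0 ?mulr_gt0.
have t2 : eta * (4 * C2) = c / 8 by rewrite /eta; field; rewrite gt_eqF.
clearbody eta.
pose kap := c * eta / (2 * C4).
have k0 : 0 < kap by rewrite divr_gt0 ?mulr_gt0.
have kapE : (4 * eta)^-1 * (kap * C4) = c / 8 by rewrite /kap; field; rewrite !gt_eqF.
clearbody kap.
pose r := 2 * eta * kap * c.
have r0 : 0 < r by rewrite !mulr_gt0.
have rE : (4 * eta)^-1 * ((4 * kap)^-1 * r) = c / 8 by rewrite /r; field; rewrite !gt_eqF.
clearbody r.
pose delta := c / (8 * (2 + C4)).
have C42 : 0 < 2 + C4 by rewrite addr_gt0.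
have d0 : 0 < delta by rewrite divr_gt0 ?mulr_gt0.
have dE : delta * (2 + C4) = c / 8 by rewrite /delta; field; rewrite gt_eqF.
clearbody delta.
have [e0 e00 He] := H delta r d0 r0.
have min_gt0 : 0 < Num.min e0 T by rewrite lt_min e00.
have [m] := exists_ratio_lt T0 min_gt0.
rewrite lt_min; set e' := T / _ => /andP[e'e0 e'T].
have e'0 : 0 < e' by rewrite divr_gt0.
pose M := e'^-1 * T * (8 * expR 2^-1 * cbrt e' * cbrt (4 * T)).
have M0 : 0 < M.
  have c1 : 0 < cbrt e' by rewrite cbrt_gt0// gt_eqF.
  have c2 : 0 < cbrt (4 * T) by rewrite cbrt_gt0// gt_eqF// mulr_gt0.
  by rewrite /M !mulr_gt0 ?invr_gt0 ?expR_gt0.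
have cM : 0 < c / (4 * M) by rewrite divr_gt0// mulr_gt0.
have rM : 0 < (c / (4 * M)) ^+ 3 by exact: exprn_gt0.
have min2_gt0 : 0 < Num.min e0 ((c / (4 * M)) ^+ 3) by rewrite lt_min e00.
(* The step [e] is chosen after [e'], small enough to make [M * cbrt e <= c / 4]. It divides
   [T], so that a whole number of steps covers [0, T + 2 e]. *)
have [n] := exists_ratio_lt T0 min2_gt0.
rewrite lt_min; set e := T / _ => /andP[ee0 erM].
have en0 : 0 < e by rewrite divr_gt0.
pose N := n.+3.
have n0 : 0 < n.+1%:R :> R by [].
have NE : N%:R * e = T + 2 * e.
  rewrite /N -addn2 natrD mulrDl /e; congr (_ + _).
  by rewrite mulrC divfK// gt_eqF.
have eT : e <= T by rewrite /e ler_pdivrMr// ler_peMr ?(ltW T0)// ler1n.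
have lo : c <= mean (fun w => V e w * sinh_sum X e N w).
  by rewrite -cE; apply: (mean_cubic_variation_sinh_sum_ge hX T0 en0); rewrite NE.
have NT : N%:R * e <= 3 * T by rewrite NE; lra.
have hi := mean_cubic_variation_sinh_sum_small hX T0 en0 e'0 (ltW e'T) NT.
have ce : cbrt e <= c / (4 * M).
  rewrite -(@ler_pXn2r _ 3)// ?nnegrE ?cbrt_ge0 ?(ltW cM)//.
  by rewrite cbrt_exp3 gtr0_norm// ltW.
have hi4 : mean (fun w => V e' w * sinh_sum X e N w) <= c / 4.
  apply: le_trans (ler_norm _) _; apply: le_trans hi _; rewrite -/M.
  apply: le_trans (ler_wpM2l (ltW M0) ce) _.
  by rewrite le_eqVlt; apply/orP; left; apply/eqP; field; rewrite gt_eqF.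
have mZ := sinh_sum_moments hX N en0.
have Z4 : mean (fun w => sinh_sum X e N w ^+ 4) <= C4.
  apply: le_trans (mean_sinh_sum_pow4_le hX N en0) _.
  rewrite C4E; apply: ler_wpM2l; first by rewrite !mulr_ge0 ?exprn_ge0 ?expR_ge0.
  apply: lerXn2r; rewrite ?nnegrE ?mulr_ge0 ?(ltW en0) ?(ltW T0)//.
  by rewrite ler_wpM2l.
have Pr := He e e' en0 ee0 e'0 e'e0.
have := mean_cubic_variation_diff_le en0 e'0 d0 et0 k0 mZ; rewrite C2E.
set p := fine _ in Pr *; set z := mean (fun w => sinh_sum X e N w ^+ 4) in Z4 *.
have t1 : delta * (2 + z) <= c / 8 by rewrite -dE ler_wpM2l ?(ltW d0)// lerD2l.
have c4 : 0 < (4 * eta)^-1 by rewrite invr_gt0 mulr_gt0.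
have t3 : (4 * eta)^-1 * (kap * z) <= c / 8.
  by rewrite -kapE ler_wpM2l ?(ltW c4)// ler_wpM2l// ltW.
have t4 : (4 * eta)^-1 * ((4 * kap)^-1 * p) <= c / 8.
  by rewrite -rE ler_wpM2l ?(ltW c4)// ler_wpM2l// invr_ge0 mulr_ge0// ltW.
move: lo hi4; move: (mean _) (mean _) => q q'; clearbody z p.
rewrite [(4 * eta)^-1 * (_ + _)]mulrDr; move: (4 * eta)^-1 (4 * kap)^-1 t3 t4 => u v t3 t4.
by lra.
Qed.

End no_limit.

Theorem proposition2 (R : realType) (d : measure_display)
    (Omega : measurableType d) (P : probability Omega R)
    (X : R -> {RV P >-> R}) (T : R)
    (hX : fractional_brownian_motion (6^-1) X) (hT : 0 < T) :
  (~ exists Y : Omega -> R, cvg_in_L2 P (cubic_variation X T) 0^'+ Y) /\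
  (~ exists Y : {RV P >-> R},
       cvg_in_probability (cubic_variation X T) 0^'+ Y).
Proof.
have mV := cubic_variation_measurable hX T.
suff no_prob : ~ exists Y : {RV P >-> R},
    cvg_in_probability (cubic_variation X T) 0^'+ Y.
  split=> // -[Y cV]; apply: no_prob.
  exact: (cvg_in_L2_probability mV cV).
move=> [Y cV]; apply: (not_cauchy_in_probability hX hT).
exact: (cvg_in_probability_cauchy mV cV).
Qed.
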